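(* There exists an absolute constant $c$ such that, for every surface $\Sigma$ of Euler genus $g$ and all integers $\Delta\ge 3$ and $k\ge 2$, \[N(\Delta,k,\mathcal{G}_\Sigma)\le\begin{cases} c(g+1)(\Delta-1)^{\lfloor {k}/{2}\rfloor}& \text{if $k$ is even and $\Delta\ge c(g^{2/3}+1)k$,}\\ c(g^{3/2}+1)(\Delta-1)^{\lfloor {k}/{2}\rfloor}& \text{if $k$ is odd and $\Delta\ge 2k+1$.} \end{cases}\]
   Context: A surface is a compact connected 2-manifold without boundary; the sphere with $h$ handles has Euler genus $2h$ and the sphere with $c$ cross-caps has Euler genus $c$. $\mathcal{G}_\Sigma$ denotes the class of graphs embeddable in the surface $\Sigma$. For a graph class $\mathcal{C}$, $N(\Delta,k,\mathcal{C})$ denotes the maximum number of vertices of a graph in $\mathcal{C}$ with maximum degree $\Delta$ and diameter $k$. *)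

(* Defs.v *)
From HB Require Import structures.
From mathcomp Require Import all_boot all_order all_algebra.
From mathcomp Require Import all_classical all_reals all_analysis.

Set Implicit Arguments.
Unset Strict Implicit.
Unset Printing Implicit Defensive.

Import Order.TTheory GRing.Theory Num.Theory.
Import numFieldNormedType.Exports.

Local Open Scope classical_set_scope.
Local Open Scope ring_scope.

(* Finite simple graphs; a graph with finite maximum degree and finite diameter
   is finite, so nothing is lost for the degree-diameter problem. *)
Record sgraph := SGraph {
  vertex :> finType;
  edge : rel vertex;
  edge_sym : symmetric edge;
  edge_irrefl : irreflexive edge }.

Definition max_degree (G : sgraph) : nat :=
  \max_(u : G) #|[pred v : G | edge u v]|.

Definition walk (G : sgraph) (u v : G) (n : nat) : Prop :=
  exists p : seq G, [/\ path (@edge G) u p, last u p = v & size p = n].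

Definition distance (G : sgraph) (u v : G) (n : nat) : Prop :=
  walk u v n /\ forall m, walk u v m -> (n <= m)%N.

Definition diameter (G : sgraph) (k : nat) : Prop :=
  (forall u v : G, exists2 n, distance u v n & (n <= k)%N) /\
  (exists u v : G, distance u v k).

(* N(Delta, k, C), a supremum in \bar R, so that it is total. When
   the class C contains a graph with the prescribed parameters, it is a maximum:
   the orders of these graphs are bounded in terms of Delta and k. *)
Definition max_order (R : realType) (Delta k : nat) (C : sgraph -> Prop) :
    \bar R :=
  ereal_sup [set x | exists G : sgraph,
    [/\ C G, max_degree G = Delta, diameter G k & x = (#|G|%:R)%:E]].

Definition homeomorphic_on (X Y : topologicalType) (U : set X) (V : set Y) :
    Prop :=
  exists (f : X -> Y) (g : Y -> X),
    [/\ {within U, continuous f} /\ {within V, continuous g},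
        (forall x, U x -> V (f x)) /\ (forall y, V y -> U (g y)),
        forall x, U x -> g (f x) = x & forall y, V y -> f (g y) = y].

Definition manifold2 (R : realType) (M : topologicalType) : Prop :=
  [/\ hausdorff_space M, @second_countable M &
      forall x : M, exists (U : set M) (V : set (R * R)%type),
        [/\ open U, U x, open V & homeomorphic_on U V]].

Definition surface (R : realType) (M : topologicalType) : Prop :=
  [/\ manifold2 R M, compact [set: M] & connected [set: M]].

(* The sphere, as the plane with a point at infinity. *)
Definition sphere (R : realType) : topologicalType :=
  one_point_compactification (R * R)%type.

Definition disc (R : realType) (a : R * R) : set (R * R) :=
  [set p | (p.1 - a.1) ^+ 2 + (p.2 - a.2) ^+ 2 < 1].

Definition circle (R : realType) (a : R * R) : set (R * R) :=
  [set p | (p.1 - a.1) ^+ 2 + (p.2 - a.2) ^+ 2 = 1].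

(* M is the quotient of the sphere minus the planar set D under the equivalence
   relation generated by glue, which relates any point to at most one other in
   the two uses below. There D is open, so the domain of q is compact, and q is a
   quotient map as soon as M is Hausdorff. *)
Definition glued_sphere (R : realType) (D : set (R * R))
    (glue : R * R -> R * R -> Prop) (M : topologicalType) : Prop :=
  let K : set (sphere R) := ~` (Some @` D) in
  exists q : sphere R -> M,
    [/\ {within K, continuous q},
        forall m : M, exists2 x, K x & q x = m &
        forall x y, K x -> K y ->
          (q x = q y <->
           x = y \/ exists p p' : R * R,
             [/\ x = Some p, y = Some p' & glue p p' \/ glue p' p])].

(* Handle number i: remove the unit discs centred at (4i, 0) and (4i, 4) and
   identify their boundaries by the reflection in the line y = 2. A reflection is
   needed here: a translation would produce a Klein bottle handle. *)
Definition sphere_with_handles (R : realType) (h : nat) : topologicalType ->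
    Prop :=
  @glued_sphere R
    [set p | exists2 i, (i < h)%N &
       disc ((4 * i)%:R, 0) p \/ disc ((4 * i)%:R, 4) p]
    (fun p p' => exists2 i, (i < h)%N &
       circle ((4 * i)%:R, 0) p /\ p' = (p.1, 4 - p.2)).

(* Cross-cap number i: remove the unit disc centred at (4i, 0) and identify
   antipodal points of its boundary. *)
Definition sphere_with_crosscaps (R : realType) (c : nat) : topologicalType ->
    Prop :=
  @glued_sphere R
    [set p | exists2 i, (i < c)%N & disc ((4 * i)%:R, 0) p]
    (fun p p' => exists2 i, (i < c)%N &
       circle ((4 * i)%:R, 0) p /\ p' = ((8 * i)%:R - p.1, - p.2)).

Definition euler_genus (R : realType) (M : topologicalType) (g : nat) : Prop :=
  (exists2 h : nat, sphere_with_handles R h M & g = (2 * h)%N) \/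
  sphere_with_crosscaps R g M.

(* phi places the vertices and gamma u v is the arc, parametrised by [0, 1],
   drawing the edge uv from u to v. *)
Definition embeddable (R : realType) (M : topologicalType) (G : sgraph) : Prop :=
  exists (phi : G -> M) (gamma : G -> G -> R -> M),
    [/\ injective phi,
        forall u v, edge u v ->
          [/\ {within `[0, 1], continuous (gamma u v)},
              {in `[0, 1] &, injective (gamma u v)},
              gamma u v 0 = phi u, gamma u v 1 = phi v &
              {in `[0, 1], forall t, gamma v u t = gamma u v (1 - t)}],
        forall u v w, edge u v -> {in `]0, 1[, forall t, gamma u v t <> phi w} &
        forall u v u' v', edge u v -> edge u' v' ->
          ~ ((u = u' /\ v = v') \/ (u = v' /\ v = u')) ->
          {in `]0, 1[ &, forall s t, gamma u v s <> gamma u' v' t}].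

(* Main.v *)
(** Fix for every pair of vertices a path of length at most [k] and put
    [r = k %/ 2], [b = (Delta - 1) ^ r]. If two of these paths meet, then an end of
    one of them is at distance at most [j] from the [j]-th vertex of the other,
    counted from one of its ends, for some [j <= r]; as a ball of radius [j] has
    fewer than [3 (Delta - 1) ^ j] vertices, the paths of two random pairs meet with
    probability [O(b / n)]. So for [m] of order [n / b], among [m] random
    quintuples of vertices at least [m / 2] span drawings of [K_5] along the chosen
    paths that are pairwise disjoint and in which edges without common end are
    disjoint.

    A surface of Euler genus [g] admits at most [g + 1] such drawings. All but one
    avoid the point at infinity. Lift these to the plane minus the discs of the
    gluing: by connectedness each edge becomes a chain of short steps and jumps
    along the gluing. The crossing parity of two chains is defined by counting how
    often one passes above the ends of the other; it is additive, vanishes for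
    short steps that are far apart, and jumps contribute a symmetric bilinear form
    of rank [g] over [F_2] in the numbers of passages. In a drawing of [K_5] the
    parities of the 15 independent pairs add up to 1 whatever the chains are, so
    each drawing yields two cycles on which the form is 1, while cycles of
    different drawings are orthogonal. *)

Require Import Defs.
From mathcomp Require Import all_boot all_order all_algebra.
From mathcomp Require Import ring lra zify.

Set Implicit Arguments.
Unset Strict Implicit.
Unset Printing Implicit Defensive.

(** * Disjoint quintuples in a graph of small diameter *)

Section Balls.
Variables (V : finType) (e : rel V).
Hypothesis esym : symmetric e.

Fixpoint gball j x : {set V} :=
  if j is j'.+1 then gball j' x :|: [set w | [exists y in gball j' x, e y w]]
  else [set x].

Lemma gballS j x : gball j x \subset gball j.+1 x.
Proof. exact: subsetUl. Qed.

Lemma gball_mono i j x : i <= j -> gball i x \subset gball j x.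
Proof.
move=> /subnKC <-; elim: (j - i) => [|d IH]; first by rewrite addn0.
by rewrite addnS (subset_trans IH) // gballS.
Qed.

Lemma gball_step j x y w : y \in gball j x -> e y w -> w \in gball j.+1 x.
Proof. by move=> yj yw; rewrite !inE; apply/orP; right; apply/exists_inP; exists y. Qed.

Lemma gball_path i x y p : y \in gball i x -> path e y p ->
  last y p \in gball (i + size p) x.
Proof.
elim: p i y => [|z p IH] i y /=; first by rewrite addn0.
by move=> yi /andP[yz zp]; rewrite addnS -addSn IH // (gball_step yi).
Qed.

Lemma gball_path_rev u p : path e u p -> u \in gball (size p) (last u p).
Proof.
elim: p u => [|z p IH] u /=; first by rewrite inE.
by case/andP => uz zp; apply: gball_step (IH z zp) _; rewrite esym.
Qed.

(** * Meeting paths and balls around their vertices *)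

Section Halves.
Variables (k : nat) (P : V -> V -> seq V).
Let r := k %/ 2.
Hypothesis P_path : forall u v, path e u (P u v).
Hypothesis P_last : forall u v, last u (P u v) = v.
Hypothesis P_size : forall u v, size (P u v) <= k.

Definition meet u v u' v' := has (mem (u :: P u v)) (u' :: P u' v').

Definition endp (s : bool) (u v : V) := if s then v else u.

(** The flag selects the end from which the path is read, [true] meaning backwards from [v].
    Positions beyond the path give the default [u], which can only enlarge [close_to]. *)
Definition from_end (s : bool) (u v : V) j :=
  nth u (if s then rev (u :: P u v) else u :: P u v) j.

Definition close_to s u v w := [exists j : 'I_r.+1, w \in gball j (from_end s u v j)].

(** Of the two pieces into which [x] cuts the path, one has length at most [r]: if the first has
    more than [r] edges, the second has at most [k - r - 1 <= r]. *)
Lemma path_half u v x : x \in u :: P u v ->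
  exists s j, [/\ j <= r, x = from_end s u v j & endp s u v \in gball j x].
Proof.
move=> xP; have := P_path u v; have := P_last u v; have := P_size u v.
rewrite /from_end; case/splitPl: xP => p1 p2 lx; rewrite size_cat last_cat cat_path.
rewrite lx => sk lv /andP[p1p p2p].
have nx : nth u (u :: p1 ++ p2) (size p1) = x.
  by rewrite -cat_cons nth_cat /= ltnSn -last_nth.
have [p1r|p1r] := leqP (size p1) r.
  by exists false, (size p1); split=> //; rewrite -lx; exact: gball_path_rev.
exists true, (size p2); split.
- move: sk p1r; rewrite /r; move: (size p1) (size p2) => a c H1 H2.
  by have := divn_eq k 2; have := ltn_pmod k (isT : 0 < 2); lia.
- by rewrite nth_rev /= size_cat ?subSS ?addnK // ltnS leq_addl.
- by rewrite /= -{1}lv; apply: (@gball_path 0); rewrite ?inE.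
Qed.

(** A common vertex is the [j]-th of one path and the [l]-th of the other, from suitable ends. If
    [l <= j], the end of the second path lies in the ball of radius [j] about the [j]-th vertex of
    the first; otherwise the roles change. So for each path and each end only one ball of each
    radius is needed, and the sizes add up geometrically. *)
Lemma meet_close u v u' v' : meet u v u' v' ->
  exists s s', close_to s u v (endp s' u' v') || close_to s' u' v' (endp s u v).
Proof.
case/hasP => x x' /= x1; have [s [j [jr xj ej]]] := path_half x1.
have [s' [l [lr xl el]]] := path_half x'.
exists s, s'; have [lj|jl] := leqP l j; apply/orP; [left|right]; apply/existsP.
  exists (Ordinal (jr : j < r.+1)) => /=; rewrite -xj; apply: subsetP el.
  exact: gball_mono.
exists (Ordinal (lr : l < r.+1)) => /=; rewrite -xl; apply: subsetP ej.
by apply: gball_mono; exact: ltnW.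
Qed.
End Halves.

(** * Sizes of balls under a degree bound *)

Section Degree.
Variable Delta : nat.
Hypothesis Delta3 : 2 < Delta.
Hypothesis degree_le : forall u, #|[pred v | e u v]| <= Delta.

Lemma card_bigcup_bound (T : finType) (A : {set T}) (F : T -> {set T}) b :
  (forall y, y \in A -> #|F y| <= b) -> #|\bigcup_(y in A) F y| <= b * #|A|.
Proof.
move=> H; rewrite mulnC -sum_nat_const; elim/big_rec2: _ => [|y c S yA IH].
  by rewrite cards0.
by rewrite cardsU (leq_trans (leq_subr _ _)) // leq_add // H.
Qed.

(** A vertex of one layer has a neighbour further inside, which leaves at most [Delta - 1]
    neighbours for the next layer. *)
Lemma card_layer j x : #|gball j.+1 x :\: gball j x| <= Delta * (Delta - 1) ^ j.
Proof.
elim: j => [|j IH].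
  rewrite muln1 (leq_trans _ (degree_le x)) // subset_leq_card //.
  apply/subsetP => w; rewrite !inE => /andP[wx /orP[/eqP E|]].
    by rewrite E eqxx in wx.
  by case/exists_inP => y; rewrite inE => /eqP ->.
rewrite expnS mulnCA (leq_trans _ (leq_mul (leqnn _) IH)) //.
apply: (leq_trans _ (card_bigcup_bound
  (F := fun y => [set w | e y w] :\: gball j x) _)).
  apply/subset_leq_card/subsetP => w; rewrite in_setD => /andP[wj].
  rewrite [w \in _](in_setU) (negbTE wj) /= inE => /exists_inP[y yj yw].
  apply/bigcupP; exists y.
    rewrite in_setD yj andbT; apply: contra wj => yj'; exact: gball_step yj' yw.
  rewrite in_setD inE yw andbT; apply: contra wj; exact/subsetP/gballS.
move=> y; rewrite in_setD => /andP[yj]; rewrite [y \in _]in_setU (negbTE yj) /= inE.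
case/exists_inP => u uj uy.
have : 0 < #|[set w | e y w] :&: gball j x|.
  by apply/card_gt0P; exists u; rewrite !inE esym uy.
have := cardsID (gball j x) [set w | e y w]; have := degree_le y.
have -> : #|[pred v | e y v]| = #|[set w | e y w]| by rewrite cardsE; apply: eq_card.
lia.
Qed.

Lemma card_gball j x : #|gball j x| + 2 <= 3 * (Delta - 1) ^ j.
Proof.
elim: j => [|j IH]; first by rewrite cards1.
rewrite -(cardsID (gball j x)) (setIidPr (gballS j x)).
have := card_layer j x; rewrite expnS.
(* This inequality, equivalent to [3 <= Delta], closes the induction with the factor 3. *)
set b := (Delta - 1) ^ j; have : Delta + 3 <= 3 * (Delta - 1) by lia.
by move=> H1 H2; have := leq_mul H1 (leqnn b); nia.
Qed.

Lemma sum_card_gball r (x : 'I_r.+1 -> V) :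
  \sum_(j < r.+1) #|gball j (x j)| <= 6 * (Delta - 1) ^ r.
Proof.
apply: (@leq_trans (\sum_(j < r.+1) 3 * (Delta - 1) ^ j)).
  by apply: leq_sum => j _; have := card_gball j (x j); lia.
(* A geometric sum of ratio at least 2 is at most twice its last term. *)
rewrite -big_distrr /= (_ : 6 = 3 * 2) // -mulnA leq_mul2l /=.
elim: r {x} => [|r IH]; first by rewrite big_ord1 expn0.
by rewrite big_ord_recr /= expnS; move: IH; set s := \sum_(_ < _) _; nia.
Qed.

Lemma close_to_card k P s u v :
  #|[set w | close_to k P s u v w]| <= 6 * (Delta - 1) ^ (k %/ 2).
Proof.
apply: leq_trans (sum_card_gball (fun j : 'I_(k %/ 2).+1 => from_end P s u v j)).
rewrite (_ : [set w | _] = \bigcup_(j < (k %/ 2).+1) gball j (from_end P s u v j)).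
  elim/big_rec2: _ => [|j c S _ IH]; first by rewrite cards0.
  by rewrite cardsU (leq_trans (leq_subr _ _)) // leq_add.
apply/setP => w; rewrite inE; apply/existsP/bigcupP => [[j H]|[j _ H]]; by exists j.
Qed.

End Degree.
End Balls.

(** For uniform random [f], the value [f g] is independent of the other values, hence of [X f], and
    so falls into [X f] with probability at most [b / #|V|]. *)
Lemma card_resample (I V : finType) (g : I) (X : {ffun I -> V} -> {set V}) b :
  (forall f f' : {ffun I -> V}, (forall i, i != g -> f i = f' i) -> X f = X f') ->
  (forall f, #|X f| <= b) ->
  #|[set f : {ffun I -> V} | f g \in X f]| * #|V| <= b * #|{ffun I -> V}|.
Proof.
move=> Xg Xb; pose upd (f : {ffun I -> V}) w := [ffun i => if i == g then w else f i].
have Xu f w : X (upd f w) = X f.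
  by apply: Xg => i ig; rewrite ffunE (negbTE ig).
(* This involution exchanges the value at [g] with the second component and leaves [X] unchanged. *)
pose phi (x : {ffun I -> V} * V) := (upd x.1 x.2, x.1 g).
have phiK : cancel phi (fun y => (upd y.1 y.2, y.1 g)).
  move=> [f w]; rewrite /phi /=; congr pair; last by rewrite ffunE eqxx.
  by apply/ffunP => i; rewrite !ffunE; case: eqP => // ->.
pose S := [set y : {ffun I -> V} * V | y.2 \in X y.1].
have : #|phi @: setX [set f : {ffun I -> V} | f g \in X f] [set: V]| <= #|S|.
  apply/subset_leq_card/subsetP => _ /imsetP[[f w] /setXP[+ _] ->].
  by rewrite !inE /phi /= Xu.
rewrite (card_imset _ (can_inj phiK)) cardsX cardsT => /leq_trans; apply.
rewrite -sum1_card (eq_bigl (fun y => true && (y.2 \in X y.1))); last first.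
  by move=> y; rewrite inE.
rewrite -(pair_big_dep xpredT (fun f w => w \in X f) (fun _ _ => 1)) /=.
rewrite mulnC -sum_nat_const; apply: leq_sum => f _; by rewrite sum1_card.
Qed.

(** * Random quintuples and the first-moment argument *)

Section Blocks.
Variables (V : finType) (e : rel V) (Delta k : nat) (P : V -> V -> seq V).
Hypothesis esym : symmetric e.
Hypothesis Delta3 : 2 < Delta.
Hypothesis degree_le : forall u, #|[pred v | e u v]| <= Delta.
Hypothesis P_path : forall u v, path e u (P u v).
Hypothesis P_last : forall u v, last u (P u v) = v.
Hypothesis P_size : forall u v, size (P u v) <= k.
Let b := 6 * (Delta - 1) ^ (k %/ 2).

Lemma card_close_slots (I : finType) s (x y g : I) : x != g -> y != g ->
  #|[set f : {ffun I -> V} | close_to e k P s (f x) (f y) (f g)]| * #|V|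
    <= b * #|{ffun I -> V}|.
Proof.
move=> xg yg; pose X (f : {ffun I -> V}) := [set w | close_to e k P s (f x) (f y) w].
rewrite (_ : [set f | _] = [set f : {ffun I -> V} | f g \in X f]).
  apply: card_resample => [f f' H|f]; first by rewrite /X !H.
  exact: close_to_card.
by apply/setP => f; rewrite !inE.
Qed.

(** Union bound: there are four choices of an end of each path and two closeness events for each
    choice, every event of probability at most [b / #|V|]. *)
Lemma card_meet_slots (I : finType) (x y x' y' : I) :
  x != x' -> x != y' -> y != x' -> y != y' ->
  #|[set f : {ffun I -> V} | meet P (f x) (f y) (f x') (f y')]| * #|V|
    <= 8 * b * #|{ffun I -> V}|.
Proof.
move=> n1 n2 n3 n4.
pose A s (u v w : I) := [set f : {ffun I -> V} | close_to e k P s (f u) (f v) (f w)].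
have AB s (u v w : I) : u != w -> v != w -> #|A s u v w| * #|V| <= b * #|{ffun I -> V}|.
  exact: card_close_slots.
pose U (ss : bool * bool) :=
  A ss.1 x y (endp ss.2 x' y') :|: A ss.2 x' y' (endp ss.1 x y).
have sub : [set f : {ffun I -> V} | meet P (f x) (f y) (f x') (f y')]
    \subset \bigcup_ss U ss.
  apply/subsetP => f; rewrite inE => /(meet_close esym P_path P_last P_size).
  move=> [s [s' H]]; apply/bigcupP; exists (s, s') => //; rewrite !inE /=.
  by move: H; case: s; case: s'.
rewrite (leq_trans (leq_mul (subset_leq_card sub) (leqnn _))) //.
have UB ss : #|U ss| * #|V| <= 2 * b * #|{ffun I -> V}|.
  have U2 : #|U ss| <= #|A ss.1 x y (endp ss.2 x' y')| +
      #|A ss.2 x' y' (endp ss.1 x y)|.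
    by rewrite cardsU leq_subr.
  rewrite (leq_trans (leq_mul U2 (leqnn _))) // mulnDl -mulnA mul2n -addnn leq_add //.
    by apply: AB; case: ss.2.
  by apply: AB; case: ss.1; rewrite eq_sym.
have : #|\bigcup_ss U ss| <= \sum_ss #|U ss|.
  elim/big_rec2: _ => [|ss c S _ IH]; first by rewrite cards0.
  by rewrite cardsU (leq_trans (leq_subr _ _)) // leq_add.
move/leq_mul/(_ (leqnn #|V|))/leq_trans; apply; rewrite big_distrl /=.
apply: (@leq_trans (\sum_(ss : bool * bool) 2 * b * #|{ffun I -> V}|)).
  by apply: leq_sum => ss _; exact: UB.
by rewrite sum_nat_const card_prod card_bool; lia.
Qed.

Definition slots m : finType := ('I_m * 'I_5 * 'I_5 * ('I_m * 'I_5 * 'I_5))%type.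

(** The forbidden intersections: any between two different quintuples, and within one quintuple
    those of two edges of [K_5] without common end. *)
Definition clash m (f : {ffun 'I_m * 'I_5 -> V}) (x : slots m) : bool :=
  let: (s, i, j, (t, i', j')) := x in
  ((s != t) || uniq [:: i; j; i'; j'])
    && meet P (f (s, i)) (f (s, j)) (f (t, i')) (f (t, j')).

(** Some [f] has at most the average number of clashes. There are [625 * m ^ 2] slots, each clashing
    with probability at most [8 * b / #|V|], and [625 * 8 = 5000]. *)
Lemma few_clashes m : 0 < #|V| -> exists f : {ffun 'I_m * 'I_5 -> V},
  #|[set x | clash f x]| * #|V| <= 5000 * m ^ 2 * b.
Proof.
move=> V0; pose F := {ffun 'I_m * 'I_5 -> V}.
have F0 : 0 < #|{: F}| by rewrite card_ffun expn_gt0 V0.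
have tot : \sum_(f : F) #|[set x | clash f x]| * #|V| <= 5000 * m ^ 2 * b * #|{: F}|.
  rewrite -big_distrl /=.
  rewrite (eq_bigr (fun f : F => \sum_(x : slots m) clash f x)); last first.
    by move=> f _; rewrite -sum1dep_card big_mkcond.
  rewrite exchange_big /= big_distrl /=.
  apply: (@leq_trans (\sum_(x : slots m) 8 * b * #|{: F}|)); last first.
    by rewrite sum_nat_const !card_prod !card_ord; nia.
  apply: leq_sum => -[[[s i] j] [[t i'] j']] _ /=.
  have [/= c|_] := boolP ((s != t) || _); last by rewrite big1 // mul0n.
  rewrite (_ : \sum_(f : F) _ = #|[set f : F | meet P (f (s, i)) (f (s, j))
    (f (t, i')) (f (t, j'))]|); last by rewrite -sum1dep_card [RHS]big_mkcond.
  have ne (a a' : 'I_5) : (s != t) || (a != a') -> (s, a) != (t, a').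
    by move=> H; rewrite xpair_eqE negb_and.
  apply: card_meet_slots; apply: ne; case/orP: c => [-> //|];
    rewrite /= !inE !negb_or; move=> /and4P[/and3P[H1 H2 H3] /andP[H4 H5] _ _];
    by rewrite ?H2 ?H3 ?H4 ?H5 orbT.
have [f Hf|H] := pickP (fun f : F => #|[set x | clash f x]| * #|V| <= 5000 * m ^ 2 * b).
  by exists f.
have : (5000 * m ^ 2 * b).+1 * #|{: F}| <= \sum_(f : F) #|[set x | clash f x]| * #|V|.
  rewrite mulnC -sum_nat_const; apply: leq_sum => f _.
  by rewrite ltnNge H.
move/leq_trans/(_ tot); rewrite leq_pmul2r //; lia.
Qed.

(** The assumption on [m] leaves at most [m / 2] clashes. Discarding the first quintuple of each
    clash destroys all of them. *)
Lemma disjoint_blocks m : 0 < #|V| -> 2 * 5000 * m * b <= #|V| ->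
  exists (B : {set 'I_m}) (f : 'I_m -> 'I_5 -> V), m <= 2 * #|B| /\
    forall s t i j i' j', s \in B -> t \in B -> (s != t) || uniq [:: i; j; i'; j'] ->
    ~~ meet P (f s i) (f s j) (f t i') (f t j').
Proof.
move=> V0 mV; have [f Hf] := few_clashes m V0.
pose C := [set x | clash f x]; pose bad := [set x.1.1.1 | x in C].
exists (~: bad), (fun s i => f (s, i)); split; last first.
  move=> s t i j i' j'; rewrite inE => sB _ c; apply: contra sB => M.
  by apply/imsetP; exists (s, i, j, (t, i', j')); rewrite ?inE //=; apply/andP.
have : #|bad| <= #|C| by exact: leq_imset_card.
have := cardsC bad; rewrite card_ord.
have : 2 * #|C| <= m.
  move: (b) Hf mV => c Hf mV; rewrite -(leq_pmul2r V0) -mulnA.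
  rewrite (leq_trans (leq_mul (leqnn 2) Hf)) //.
  rewrite (leq_trans _ (leq_mul (leqnn m) mV)) // [leqRHS]mulnC -mulnn !mulnA.
  by rewrite (mulnAC _ m c).
move: #|C| #|bad| #|~: bad| => c d d'; lia.
Qed.
End Blocks.

From mathcomp Require Import all_classical all_reals all_analysis.
Import Order.TTheory GRing.Theory Num.Theory.
Import numFieldNormedType.Exports.
Local Open Scope ring_scope.

(** * Forms in characteristic two *)

Section CharacteristicTwo.
Variables (F : comNzRingType) (U : zmodType) (b : U -> U -> F).
Hypothesis F2 : 1 + 1 = 0 :> F.
Hypothesis bDl : forall x y z, b (x + y) z = b x z + b y z.
Hypothesis bC : forall x y, b x y = b y x.

Let bDr x y z : b x (y + z) = b x y + b x z.
Proof. by rewrite bC bDl !(bC _ x). Qed.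

(** [Y i j] stands for the edge [ij], [H i j k] for its passages above vertex [k], [L] for the order
    of the vertices, and [T i j] for the triangle [0 i j]. Of the 27 products, 12 are products of
    edges at 0 and cancel in pairs; the rest are the 15 independent pairs of [K_5]. There every [H]
    occurs twice and every pair of vertices six times in [L]. Of these order terms 21 are reversed
    and contribute 1 each, an odd number. *)
Lemma K5_form_sum (Y : nat -> nat -> U) (H : nat -> nat -> nat -> F)
    (L : nat -> nat -> F) (T := fun i j => Y 0 i + Y i j + Y 0 j) :
  (forall i j, (i < 5)%N -> (j < 5)%N -> i != j -> L j i = 1 + L i j) ->
  (forall i j k l, (i < j < 5)%N -> (k < l < 5)%N -> uniq [:: i; j; k; l] ->
    b (Y i j) (Y k l) =
      H i j k + H i j l + H k l i + H k l j + (L i k + L i l + L j k + L j l)) ->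
  b (T 1%N 2%N) (T 3%N 4%N) + b (T 1%N 3%N) (T 2%N 4%N)
    + b (T 1%N 4%N) (T 2%N 3%N) = 1.
Proof.
move=> HL HX; rewrite /T !bDl !bDr.
rewrite (bC (Y 0 3) (Y 0 2)).
rewrite (bC (Y 0 4) (Y 0 2)) (bC (Y 0 4) (Y 0 3)).
rewrite (HX 0 1 3 4) // (HX 1 2 0 3) // (HX 1 2 3 4) // (HX 1 2 0 4) // (HX 0 2 3
  4) // (HX 0 1 2 4) // (HX 1 3 0 2) // (HX 1 3 2 4) // (HX 1 3 0 4) // (HX
  0 3 2 4) // (HX 0 1 2 3) // (HX 1 4 0 2) // (HX 1 4 2 3) // (HX 1 4 0 3)
  // (HX 0 4 2 3) //.
rewrite ?(HL 0 1) // ?(HL 0 2) // ?(HL 0 3) // ?(HL 0 4) // ?(HL 1 2) // ?(HL 1 3) //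
  ?(HL 1 4) // ?(HL 2 3) // ?(HL 2 4) // ?(HL 3 4) //.
set S := H 0 1 2 + H 0 1 3 + H 0 1 4 + H 0 2 1 + H 0 2 3 + H 0 2 4 + H 0 3 1 + H 0
  3 2 + H 0 3 4 + H 0 4 1 + H 0 4 2 + H 0 4 3 + H 1 2 0 + H 1 2 3 + H 1 2 4
  + H 1 3 0 + H 1 3 2 + H 1 3 4 + H 1 4 0 + H 1 4 2 + H 1 4 3 + H 2 3 0 + H
  2 3 1 + H 2 3 4 + H 2 4 0 + H 2 4 1 + H 2 4 3 + H 3 4 0 + H 3 4 1 + H 3 4
  2.
pose S' := L 0 1 + L 0 2 + L 0 3 + L 0 4 + L 1 2 + L 1 3 + L 1 4 + L 2 3 + L 2 4 + L
  3 4.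
pose B := b (Y 0 1) (Y 0 2) + b (Y 0 1) (Y 0 3) + b (Y 0 1) (Y 0 4) + b (Y 0 2) (Y 0
  3) + b (Y 0 2) (Y 0 4) + b (Y 0 3) (Y 0 4).
transitivity (1 + (1 + 1) * (S + 3 * S' + 10 + B)); last by rewrite F2 mul0r addr0.
by rewrite /S /S' /B; ring.
Qed.

(** Each vertex of a triangle lies on two of its edges, so in the sum over all nine pairs of edges
    every [H] and [H'] occurs twice and every [L] four times. *)
Lemma triangle_form_eq0 (Y Y' : nat -> nat -> U) (H H' : nat -> nat -> nat -> F)
    (L : nat -> nat -> F) (i j k l : nat) :
  (forall i j k l, (i < j < 5)%N -> (k < l < 5)%N ->
    b (Y i j) (Y' k l) =
      H i j k + H i j l + H' k l i + H' k l j + (L i k + L i l + L j k + L j l)) ->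
  (0 < i < j)%N -> (j < 5)%N -> (0 < k < l)%N -> (l < 5)%N ->
  b (Y 0 i + Y i j + Y 0 j) (Y' 0 k + Y' k l + Y' 0 l) = 0.
Proof.
move=> HX /andP[i0 ij] j5 /andP[k0 kl] l5.
have [k5 i5] := (ltn_trans kl l5, ltn_trans ij j5).
have [j0 l0] := (ltn_trans i0 ij, ltn_trans k0 kl).
rewrite !bDl !bDr !HX ?i0 ?i5 ?j0 ?j5 ?ij ?k0 ?kl ?l0 ?k5 ?l5 //.
pose S := H 0 i 0 + H 0 i k + H 0 i l + H i j 0 + H i j k + H i j l
  + H 0 j 0 + H 0 j k + H 0 j l.
pose S' := H' 0 k 0 + H' 0 k i + H' 0 k j + H' k l 0 + H' k l i + H' k l j
  + H' 0 l 0 + H' 0 l i + H' 0 l j.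
pose S'' := L 0 0 + L 0 k + L 0 l + L i 0 + L i k + L i l + L j 0 + L j k + L j l.
transitivity ((1 + 1) * (S + S' + (1 + 1) * S'')); last by rewrite F2 mul0r.
by rewrite /S /S' /S''; ring.
Qed.
End CharacteristicTwo.

(** The identity matrix of size [#|I|] factors through a space of dimension [#|K|]. *)
Lemma dual_families_bound (F : fieldType) (I K : finType) (z z' : I -> K -> F) :
  (forall s t, \sum_k z s k * z' t k = (s == t)%:R) -> (#|I| <= #|K|)%N.
Proof.
move=> H; pose A := \matrix_(s < #|I|, k < #|K|) z (enum_val s) (enum_val k).
pose B := \matrix_(k < #|K|, t < #|I|) z' (enum_val t) (enum_val k).
have AB : A *m B = 1%:M.
  apply/matrixP => s t; rewrite !mxE -(inj_eq enum_val_inj) -H.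
  rewrite (reindex _ (onW_bij _ (@enum_val_bij K))).
  by apply: eq_bigr => k _; rewrite !mxE.
by rewrite -(mxrank1 F #|I|) -AB (leq_trans (mxrankM_maxl _ _)) // rank_leq_col.
Qed.

(** * Crossing parities in the plane *)

Section Plane.
Variable R : realFieldType.
Implicit Types (p q v a b c d o : R * R) (e r : R) (h : R * R -> bool).

Definition near_pt e p q := (`|p.1 - q.1| < e) && (`|p.2 - q.2| < e).

Definition lex p q := (p.1 < q.1) || ((p.1 == q.1) && (p.2 < q.2)).

Definition btw p q v := lex p v (+) lex q v.

(* [h v] is the parity of the passages above [v] of a path from [p] to [q]. For
   paths in general position this is the parity of their crossings; ordering
   points lexicographically rather than by abscissa removes that condition. *)
Definition crossing h h' p q p' q' :=
  h p' (+) h q' (+) (h' p (+) h' q) (+) (btw p q p' (+) btw p q q').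

(** A short step is drawn horizontally at the height of [p] and then vertically to [q]. *)
Definition small_over p q v := btw p q v && (v.2 < p.2).

Definition half_jump a o v := btw a o v && (v.2 < o.2).

Lemma lexN p q : p != q -> lex q p = ~~ lex p q.
Proof.
case: p q => [x y] [x' y']; rewrite /lex /= xpair_eqE.
by case: (ltrgtP x x') => //= _; case: (ltrgtP y y').
Qed.

Lemma lex_lt p q : p.1 < q.1 -> lex p q.
Proof. by rewrite /lex => ->. Qed.

Lemma lex_gt p q : q.1 < p.1 -> lex p q = false.
Proof. by rewrite /lex => H; rewrite ltNge (ltW H) /= gt_eqF. Qed.

Lemma lex_le p q : lex p q -> p.1 <= q.1.
Proof. by case/orP => [/ltW|/andP[/eqP-> _]]. Qed.

Lemma lexF_le p q : ~~ lex p q -> q.1 <= p.1.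
Proof. by move=> H; rewrite leNgt; apply: contra H; apply: lex_lt. Qed.

Lemma btw_x p q v : btw p q v ->
  ((p.1 <= v.1) && (v.1 <= q.1)) || ((q.1 <= v.1) && (v.1 <= p.1)).
Proof.
rewrite /btw; case E1: (lex p v); case E2: (lex q v) => //= _.
  by rewrite (lex_le E1) (@lexF_le q v) ?E2.
by rewrite (lex_le E2) (@lexF_le p v) ?E1 // orbT.
Qed.

Lemma btw_near e p q v : near_pt e p q -> btw p q v -> `|v.1 - p.1| < e.
Proof.
case/andP => + _ /btw_x; rewrite !ltr_norml => /andP[H1 H2].
case/orP => /andP[H3 H4]; lra.
Qed.

(** Both sides say whether the two pairs interleave in the lexicographic order. *)
Lemma btwC p q p' q' : p != p' -> p != q' -> q != p' -> q != q' ->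
  btw p q p' (+) btw p q q' = btw p' q' p (+) btw p' q' q.
Proof.
move=> H1 H2 H3 H4; rewrite /btw (lexN H1) (lexN H2) (lexN H3) (lexN H4).
by case: (lex p p'); case: (lex p q'); case: (lex q p'); case: (lex q q').
Qed.

Lemma crossingC h h' p q p' q' : p != p' -> p != q' -> q != p' -> q != q' ->
  crossing h' h p' q' p q = crossing h h' p q p' q'.
Proof.
move=> H1 H2 H3 H4; rewrite /crossing (btwC H1 H2 H3 H4).
by rewrite (addbC (h' p (+) _)).
Qed.

Lemma crossing_lt_x h h' p q p' q' :
  p.1 < p'.1 -> p.1 < q'.1 -> q.1 < p'.1 -> q.1 < q'.1 ->
  h p' = false -> h q' = false -> h' p = false -> h' q = false ->
  crossing h h' p q p' q' = false.
Proof.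
move=> H1 H2 H3 H4 H5 H6 H7 H8.
by rewrite /crossing /btw !lex_lt // H5 H6 H7 H8.
Qed.

Lemma small_over_out p q v : v.1 < p.1 -> v.1 < q.1 -> small_over p q v = false.
Proof. by move=> H1 H2; rewrite /small_over /btw !lex_gt. Qed.

Lemma small_over_out' p q v : p.1 < v.1 -> q.1 < v.1 -> small_over p q v = false.
Proof. by move=> H1 H2; rewrite /small_over /btw !lex_lt. Qed.

Lemma near_ptW e e' p q : e <= e' -> near_pt e p q -> near_pt e' p q.
Proof. by move=> H /andP[H1 H2]; rewrite /near_pt !(lt_le_trans _ H). Qed.

Lemma near_ptC e p q : near_pt e p q = near_pt e q p.
Proof. by rewrite /near_pt distrC (distrC p.2). Qed.

Lemma near_ptxx e p : 0 < e -> near_pt e p p.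
Proof. by move=> H; rewrite /near_pt !subrr normr0 H. Qed.

Lemma apart_neq r p q : 0 < r -> ~~ near_pt r p q -> p != q.
Proof. by move=> r0; apply: contraNneq => ->; rewrite near_ptxx. Qed.

Lemma near_ptE e p q : near_pt e p q ->
  [/\ p.1 - q.1 < e, q.1 - p.1 < e, p.2 - q.2 < e & q.2 - p.2 < e].
Proof.
by case/andP; rewrite !ltr_norml => /andP[H1 H2] /andP[H3 H4]; split; lra.
Qed.

Lemma apartE r p q : ~~ near_pt r p q ->
  [\/ r <= p.1 - q.1, r <= q.1 - p.1, r <= p.2 - q.2 | r <= q.2 - p.2].
Proof.
rewrite negb_and -!leNgt !ler_normr => /orP[] /orP[] H.
- exact: Or41.
- by apply: Or42; lra.
- exact: Or43.
- by apply: Or44; lra.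
Qed.

Lemma crossing_small_lt_x e p q p' q' : near_pt e p q -> near_pt e p' q' ->
  p.1 + 2 * e <= p'.1 ->
  crossing (small_over p q) (small_over p' q') p q p' q' = false.
Proof.
move=> /near_ptE[? ? ? ?] /near_ptE[? ? ? ?] ?.
have [H1 H2 H3 H4] : [/\ p.1 < p'.1, p.1 < q'.1, q.1 < p'.1 & q.1 < q'.1].
  by split; lra.
apply: crossing_lt_x => //; by [exact: small_over_out'|exact: small_over_out].
Qed.

(** The lower step passes above neither end of the upper one. The upper step passes above those ends
    of the lower one that lie between its own, and this parity cancels the order term by [btwC]. *)
Lemma crossing_small_lt_y e p q p' q' : near_pt e p q -> near_pt e p' q' ->
  p.2 + 2 * e <= p'.2 ->
  crossing (small_over p q) (small_over p' q') p q p' q' = false.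
Proof.
move=> /near_ptE[? ? ? ?] /near_ptE[? ? ? ?] ?.
have neq (a b : R * R) : a.2 < b.2 -> a != b.
  by move=> ab; apply: contraTneq ab => ->; rewrite ltxx.
have [H1 H2 H3 H4] : [/\ p.2 < p'.2, p.2 < q'.2, q.2 < p'.2 & q.2 < q'.2].
  by split; lra.
rewrite /crossing (btwC (neq _ _ H1) (neq _ _ H2) (neq _ _ H3) (neq _ _ H4)).
rewrite /small_over H1 H3 !andbT ltNge (ltW H1) (ltNge q'.2) (ltW H2) !andbF /=.
by rewrite addbb.
Qed.

Lemma crossing_small e r p q p' q' : 0 < e -> 2 * e <= r ->
  near_pt e p q -> near_pt e p' q' -> ~~ near_pt r p p' ->
  ~~ near_pt r p q' -> ~~ near_pt r q p' -> ~~ near_pt r q q' ->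
  crossing (small_over p q) (small_over p' q') p q p' q' = false.
Proof.
move=> e0 er H1 H2 A1 A2 A3 A4; have r0 : 0 < r by lra.
have := apart_neq r0 A4; have := apart_neq r0 A3.
have := apart_neq r0 A2; have := apart_neq r0 A1 => ? ? ? ?.
case: (apartE A1) => H.
- by rewrite -crossingC // (crossing_small_lt_x H2 H1) //; lra.
- by rewrite (crossing_small_lt_x H1 H2) //; lra.
- by rewrite -crossingC // (crossing_small_lt_y H2 H1) //; lra.
- by rewrite (crossing_small_lt_y H1 H2) //; lra.
Qed.

Definition on_circle o a := (a.1 - o.1) ^+ 2 + (a.2 - o.2) ^+ 2 = 1.
Definition off_disc o a := 1 <= (a.1 - o.1) ^+ 2 + (a.2 - o.2) ^+ 2.

(** The drop in height would force [X ^+ 2 - x ^+ 2] to be at least [r ^+ 2], hence at least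
    [4 * e], whereas close abscissas keep it below [3 * e]. *)
Lemma circle_step_false (x y X Y e r : R) : 0 < e <= 1 -> 4 * e <= r ^+ 2 ->
  0 < r -> x ^+ 2 + y ^+ 2 = 1 -> 1 <= X ^+ 2 + Y ^+ 2 -> - e < X - x < e ->
  0 <= Y -> r <= y - Y -> False.
Proof.
move=> /andP[e0 e1] er r0 Hx HX /andP[h1 h2] Y0 yY.
have [x1 x2] : -1 <= x /\ x <= 1 by split; nra.
have h3 : r ^+ 2 <= y ^+ 2 - Y ^+ 2 by nra.
have h4 : 0 <= (e - (X - x)) * (3 + (X + x)) by apply: mulr_ge0; lra.
have h5 : 0 <= (e + (X - x)) * (3 - (X + x)) by apply: mulr_ge0; lra.
nra.
Qed.

(** Outside the disc, a point close to the line of the horizontal diameter has [X >= 1 - e]; as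
    [X <= x <= 1], both points are near the end of the diameter. *)
Lemma circle_end_near (x y X Y e r : R) : 0 < e -> 4 * e <= r -> r <= 1 ->
  x ^+ 2 + y ^+ 2 = 1 -> 1 <= X ^+ 2 + Y ^+ 2 -> - e < Y < e ->
  0 <= X -> X <= x -> [/\ x - X < r, X - x < r, y - Y < r & Y - y < r].
Proof.
move=> e0 er r1 Hx HX /andP[h1 h2] X0 xX.
have Y2 : Y ^+ 2 < e ^+ 2 by nra.
have X2 : 1 - e <= X by rewrite leNgt; apply/negP => H; nra.
have x1 : x <= 1 by nra.
have y2 : y ^+ 2 < (2 * e) ^+ 2 by nra.
have [y3 y4] : y < 2 * e /\ - (2 * e) < y by split; rewrite ltNge; apply/negP => H; nra.
by split; lra.
Qed.

Lemma half_jump_parity (ac ad ca co cy ya yo : bool) : ac (+) ad = ca (+) co ->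
  (co -> cy = ~~ yo) -> (ca -> cy = ~~ ya) ->
  (ac && cy) (+) (ad && cy) (+) ((ca && ya) (+) (co && yo)) (+) (ac (+) ad) = false.
Proof.
case: ac; case: ad; case: ca; case: co; case: cy; case: ya; case: yo => //= _ H1 H2;
  by [have := H1 isT | have := H2 isT].
Qed.

(* The half jump leaves [a] vertically and reaches [o] along the horizontal
   diameter, so it stays inside the disc and can meet a short step outside the
   disc only near [a]. *)
Lemma crossing_half_jump e r o a c d : 0 < e -> 4 * e <= r ^+ 2 -> 0 < r <= 1 ->
  on_circle o a -> off_disc o c -> off_disc o d -> near_pt e c d ->
  ~~ near_pt r a c -> ~~ near_pt r a d ->
  crossing (half_jump a o) (small_over c d) a o c d = false.
Proof.
move=> e0 er /andP[r0 r1] ca oc od cd ac ad.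
have oc' : o != c.
  by apply: contraTneq isT => oc'; move: oc; rewrite /off_disc -oc' !subrr; lra.
have od' : o != d.
  by apply: contraTneq isT => od'; move: od; rewrite /off_disc -od' !subrr; lra.
have er4 : 4 * e <= r by nra.
have S := btwC (apart_neq r0 ac) (apart_neq r0 ad) oc' od'.
have cda := btw_near cd (v := a); have cdo := btw_near cd (v := o).
have [n1 n2 n3 n4] := near_ptE cd.
have Co : btw c d o -> (c.2 < o.2) = ~~ (o.2 < c.2).
  move/cdo; rewrite ltr_norml => /andP[h1 h2]; move: oc; rewrite /off_disc => oc.
  by case: (ltrgtP c.2 o.2) => // E; exfalso; rewrite E in oc; nra.
have Ca : btw c d a -> (c.2 < o.2) = ~~ (a.2 < c.2).
  move/cda; rewrite ltr_norml => /andP[h1 h2].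
  have [] : (r <= a.2 - c.2) \/ (r <= c.2 - a.2).
    by case: (apartE ac) => ?; [exfalso; lra|exfalso; lra|left|right].
    move=> A; rewrite (ltNge a.2) (_ : c.2 <= a.2) /=; last lra.
    rewrite ltNge; apply/negP => B.
    by apply: (circle_step_false (e := e) (r := r) _ er r0 ca oc); lra.
  move=> A; rewrite (_ : a.2 < c.2) /=; last lra.
  apply/negP => B.
  have ca' : (a.1 - o.1) ^+ 2 + (o.2 - a.2) ^+ 2 = 1 by rewrite -(opprB a.2) sqrrN.
  have oc2 : 1 <= (c.1 - o.1) ^+ 2 + (o.2 - c.2) ^+ 2.
    by rewrite -(opprB c.2) sqrrN.
  by apply: (circle_step_false (e := e) (r := r) _ er r0 ca' oc2); lra.
rewrite /crossing /half_jump {1}/small_over {1}/small_over.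
(* If [c] and [d] lie on different sides of the diameter, both are within [e] of its height. Then
   neither is between [a] and [o], for it would be close to [a], and [o] is not between them, for
   they would lie in the disc. *)
have [E|E] := eqVneq (c.2 < o.2) (d.2 < o.2).
  by rewrite -E; exact: half_jump_parity S Co Ca.
have [y1 y2] : `|c.2 - o.2| < e /\ `|d.2 - o.2| < e.
  move: E n3 n4; clear; rewrite !ltr_norml.
  by case: ltP => E1; case: ltP => E2 // _ n3 n4; split; apply/andP; split; lra.
have away x : off_disc o x -> ~~ near_pt r a x -> `|x.2 - o.2| < e ->
    btw a o x = false.
  move=> ox ax; rewrite ltr_norml => yx; apply/negP => /btw_x H.
  move/negP: ax; apply; rewrite /near_pt !ltr_norml.
  case/orP: H => /andP[H1 H2]; last first.
    have [] := circle_end_near e0 er4 r1 ca ox yx _ _; lra.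
  have [] := @circle_end_near (o.1 - a.1) (a.2 - o.2) (o.1 - x.1) (x.2 - o.2) e r
    e0 er4 r1 _ _ yx _ _; try lra.
    by rewrite -opprB sqrrN.
  by rewrite -opprB sqrrN.
rewrite (away c) // (away d) // in S *.
have /negbTE Fo : ~~ btw c d o.
  apply/negP => /cdo; move: y1 oc; rewrite /off_disc !ltr_norml; nra.
by move: S; rewrite Fo /=; case: (btw c d a).
Qed.
End Plane.

(** * Handles and cross-caps *)

Section Jumps.
Variable R : realFieldType.
Implicit Types (p q v a b c d o : R * R) (e r x : R).

Lemma lex_eq p q : p.1 = q.1 -> lex p q = (p.2 < q.2).
Proof. by rewrite /lex => ->; rewrite ltxx eqxx. Qed.

Lemma on_circle_bounds o a : on_circle o a ->
  [/\ -1 <= a.1 - o.1, a.1 - o.1 <= 1, -1 <= a.2 - o.2 & a.2 - o.2 <= 1].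
Proof.
rewrite /on_circle; move: (a.1 - o.1) (a.2 - o.2) => x y H.
have [y2 x2] : 0 <= y ^+ 2 /\ 0 <= x ^+ 2 by rewrite !sqr_ge0.
by split; nra.
Qed.

Lemma btwD p q s v : btw p q v (+) btw q s v = btw p s v.
Proof. by rewrite /btw; case: (lex p v); case: (lex q v); case: (lex s v). Qed.

Lemma btw_sym p q v : btw p q v = btw q p v.
Proof. exact: addbC. Qed.

(** The crossing parity is additive under concatenation; all later computations rest on this. *)
Lemma crossing_cat h h1 h2 h' p q s p' q' : h =1 (fun v => h1 v (+) h2 v) ->
  crossing h h' p s p' q' = crossing h1 h' p q p' q' (+) crossing h2 h' q s p' q'.
Proof.
move=> E; rewrite /crossing !E -!(btwD p q s).
move: (btw p q p') (btw p q q') (btw q s p') (btw q s q') => b1 b2 b3 b4.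
case: (h1 p'); case: (h1 q'); case: (h2 p'); case: (h2 q');
 case: (h' p); case: (h' q); case: (h' s); case: b1; case: b2; case: b3;
 by case: b4.
Qed.

Lemma crossing_rev h h' p q p' q' : crossing h h' q p p' q' = crossing h h' p q p' q'.
Proof. by rewrite /crossing (addbC (h' q)) !(btw_sym q). Qed.

(** The jump goes vertically to the horizontal diameter, along it, and vertically to the antipode;
    it is the sum of two half jumps. *)
Definition crosscap_over p q v := btw p q v && (v.2 < 0).

Definition antipode x p : R * R := (2 * x - p.1, - p.2).

Lemma antipode_circle x p : on_circle (x, 0) p -> on_circle (x, 0) (antipode x p).
Proof. by rewrite /on_circle /=; lra. Qed.

Lemma crossing_crosscap_small e r x a c d :
  0 < e -> 4 * e <= r ^+ 2 -> 0 < r <= 1 -> on_circle (x, 0) a ->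
  off_disc (x, 0) c -> off_disc (x, 0) d -> near_pt e c d ->
  ~~ near_pt r a c -> ~~ near_pt r a d ->
  ~~ near_pt r (antipode x a) c -> ~~ near_pt r (antipode x a) d ->
  crossing (crosscap_over a (antipode x a)) (small_over c d) a (antipode x a) c d
  = false.
Proof.
move=> e0 er r0 ca oc od cd H1 H2 H3 H4.
have E1 := crossing_half_jump e0 er r0 ca oc od cd H1 H2.
have E2 := crossing_half_jump e0 er r0 (antipode_circle ca) oc od cd H3 H4.
rewrite (@crossing_cat _ (half_jump a (x, 0)) (half_jump (antipode x a) (x, 0))
  _ _ (x, 0)); first by rewrite E1 crossing_rev E2.
by move=> v; rewrite /half_jump /= -andb_addl (btw_sym (antipode _ _)) btwD.
Qed.

(** Two pairs of antipodal points separate each other on the circle. The point reflection reverses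
    the lexicographic order, which leaves few cases. *)
Lemma crossing_crosscap x a b : on_circle (x, 0) a -> on_circle (x, 0) b ->
  a != b -> a != antipode x b ->
  crossing (crosscap_over a (antipode x a)) (crosscap_over b (antipode x b))
    a (antipode x a) b (antipode x b) = true.
Proof.
move=> ca cb ab ab'.
have lexA p q : lex (antipode x p) (antipode x q) = lex q p.
  rewrite /lex /= ltrN2; congr (_ || _ && _); first by apply/idP/idP; lra.
  by apply/eqP/eqP; lra.
have AK p : antipode x (antipode x p) = p.
  by case: p => p1 p2; rewrite /antipode /=; congr pair; ring.
have E1 : lex (antipode x b) a = ~~ lex a (antipode x b) by rewrite lexN.
have E2 : lex (antipode x a) b = lex (antipode x b) a by rewrite -{1}(AK b) lexA.
have E3 : lex b (antipode x a) = lex a (antipode x b) by rewrite -{1}(AK b) lexA.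
have E4 : lex b a = ~~ lex a b by rewrite lexN.
(* A point [p] between [q] and its antipode has nonzero height, since otherwise it would be extreme
   on the circle. So exactly one of [p] and its antipode is below the diameter. *)
have S1 p q : on_circle (x, 0) p -> on_circle (x, 0) q -> p != q ->
    p != antipode x q -> btw q (antipode x q) p -> (p.2 < 0) = ~~ (- p.2 < 0).
  move=> cp cq pq pq' /btw_x /= H.
  rewrite oppr_lt0; case: (ltrgtP p.2 0) => // p0; exfalso.
  move: cp cq; rewrite /on_circle /= p0 => cp cq.
  have : (p.1 - x) ^+ 2 <= (q.1 - x) ^+ 2 by case/orP: H => /andP[] h1 h2; nra.
  move=> H'; have q0 : q.2 = 0 by nra.
  have : (p.1 - q.1) * (p.1 + q.1 - 2 * x) = 0 by nra.
  move/eqP; rewrite mulf_eq0 => /orP[] /eqP E.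
    by move/eqP: pq; apply; apply: injective_projections; lra.
  by move/eqP: pq'; apply; apply: injective_projections; rewrite /=; lra.
have Sb := S1 _ _ cb ca; have Sa := S1 _ _ ca cb ab ab'.
have ba : b != a by rewrite eq_sym.
have ba' : b != antipode x a by apply: contra ab' => /eqP ->; rewrite AK.
move: (Sb ba ba') Sa; rewrite /crossing /crosscap_over /btw /= !lexA E2 E3 E1 E4.
do 2![case: (lex _ _)] => /=; do 4?[case: (_ < 0)] => //= H1 H2;
  solve [by [] | by have := H1 isT | by have := H2 isT].
Qed.

Lemma crosscap_over_out p q v :
  (v.1 < p.1) && (v.1 < q.1) || (p.1 < v.1) && (q.1 < v.1) ->
  crosscap_over p q v = false.
Proof.
rewrite /crosscap_over /btw; case/orP => /andP[H1 H2].
  by rewrite (lex_gt H1) (lex_gt H2).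
by rewrite (lex_lt H1) (lex_lt H2).
Qed.

Definition reflect4 p : R * R := (p.1, 4 - p.2).

(* A jump through a handle runs from [a] to the centre [(x, 0)], up to the centre
   [(x, 4)] and on to [reflect4 a]; [corridor] counts how often a short step
   crosses its middle part, which does not depend on [a]. *)
Definition handle_over x a v :=
  half_jump a (x, 0) v (+) half_jump (reflect4 a) (x, 4) v.

Definition corridor x c d :=
  crossing (fun=> false) (small_over c d) (x, 0) (x, 4) c d.

Lemma reflect4_circle x p : on_circle (x, 0) p -> on_circle (x, 4) (reflect4 p).
Proof. by rewrite /on_circle /=; lra. Qed.

Lemma crossing_handle_small e r x a c d :
  0 < e -> 4 * e <= r ^+ 2 -> 0 < r <= 1 -> on_circle (x, 0) a ->
  off_disc (x, 0) c -> off_disc (x, 0) d ->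
  off_disc (x, 4) c -> off_disc (x, 4) d -> near_pt e c d ->
  ~~ near_pt r a c -> ~~ near_pt r a d ->
  ~~ near_pt r (reflect4 a) c -> ~~ near_pt r (reflect4 a) d ->
  crossing (handle_over x a) (small_over c d) a (reflect4 a) c d = corridor x c d.
Proof.
move=> e0 er r0 ca oc od oc' od' cd H1 H2 H3 H4.
have E1 := crossing_half_jump e0 er r0 ca oc od cd H1 H2.
have E2 := crossing_half_jump e0 er r0 (reflect4_circle ca) oc' od' cd H3 H4.
rewrite (@crossing_cat _ (half_jump a (x, 0)) (half_jump (reflect4 a) (x, 4))
  _ _ (x, 0)) // E1 (@crossing_cat _ (fun=> false) (half_jump (reflect4 a) (x, 4))
  _ _ (x, 4)) //.
by rewrite [X in _ (+) (_ (+) X)]crossing_rev E2 addbF.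
Qed.

(** With [s] the value of [lex a b], the sum counts the passages above [b] and [reflect4 b] of the
    jump that starts at [a]. If [b] is at an end of the diameter, it must be the end away from
    [a]. *)
Lemma handle_sum_eq0 (s : bool) x b (u := (x, 0) : R * R) (u' := (x, 4) : R * R) :
  on_circle u b -> (b.2 = 0 -> if s then x <= b.1 else b.1 <= x) ->
  ((s (+) lex u b) && (b.2 < 0)) (+) (s (+) lex u' b)
    (+) ((s (+) lex u' (reflect4 b)) && (0 < b.2)) = false.
Proof.
move=> cb; have [_ _ b1 b2] := on_circle_bounds cb; rewrite /= in b1 b2.
case: (ltrgtP x b.1) => E.
- rewrite !lex_lt //=; case: s => //= H; case: (ltrgtP b.2 0) => // b0.
  by have := H b0; lra.
- rewrite !lex_gt //=; case: s => //= H; case: (ltrgtP b.2 0) => // b0.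
  by have := H b0; lra.
- rewrite !lex_eq //= => _; have b0 : b.2 != 0.
    apply/negP => /eqP b0; move: cb; rewrite /on_circle /= -E b0; lra.
  have -> : (4 < b.2) = false by apply/negbTE; rewrite -leNgt; lra.
  have -> : (4 < 4 - b.2) = (b.2 < 0) by apply/idP/idP; lra.
  by case: s; move: b0; case: (ltrgtP b.2 0).
Qed.

Lemma crossing_handle_lt x a b : on_circle (x, 0) a -> on_circle (x, 0) b ->
  a.1 < b.1 ->
  crossing (handle_over x a) (handle_over x b) a (reflect4 a) b (reflect4 b) = false.
Proof.
case: a b => [a1 a2] [b1 b2] ca cb /= ab.
have [ha1 ha2 ha3 ha4] := on_circle_bounds ca; rewrite /= ?subr0 in ha1 ha2 ha3 ha4.
have [hb1 hb2 hb3 hb4] := on_circle_bounds cb; rewrite /= ?subr0 in hb1 hb2 hb3 hb4.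
have Sb : b2 = 0 -> x <= b1.
  by move=> b0; move: cb; rewrite /on_circle /= b0; nra.
have Sa : a2 = 0 -> a1 <= x.
  by move=> a0; move: ca; rewrite /on_circle /= a0; nra.
have := @handle_sum_eq0 true _ _ cb Sb; have := @handle_sum_eq0 false _ _ ca Sa.
have F1 (y : R) : y <= 1 -> (4 - y < 0) = false.
  by move=> ?; apply/negbTE; rewrite -leNgt; lra.
have F2 (y : R) : y <= 1 -> (y < 4) = true by move=> ?; apply/idP; lra.
have F3 (y : R) : (4 - y < 4) = (0 < y) by apply/idP/idP; lra.
have Lt (s t : R) : lex (a1, s) (b1, t) = true by apply: lex_lt.
have Gt (s t : R) : lex (b1, t) (a1, s) = false by apply: lex_gt.
rewrite /crossing /handle_over /half_jump /btw /reflect4 /= !F3 !F1 // !F2 // !Lt !Gt.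
by rewrite !andbT !andbF /= => -> ->.
Qed.

Lemma crossing_handle_eq x a b : on_circle (x, 0) a -> on_circle (x, 0) b ->
  a.1 = b.1 -> b.2 < a.2 ->
  crossing (handle_over x a) (handle_over x b) a (reflect4 a) b (reflect4 b) = false.
Proof.
case: a b => [a1 a2] [b1 b2] ca cb /= ab ab2; subst b1.
have [ha1 ha2 ha3 ha4] := on_circle_bounds ca; rewrite /= ?subr0 in ha1 ha2 ha3 ha4.
(* The two points are mirror images in the horizontal diameter, which decides all comparisons of
   ordinates below. *)
have E : b2 = - a2.
  have : (a2 - b2) * (a2 + b2) = 0.
    by move: ca cb; rewrite /on_circle /=; nra.
  by move/eqP; rewrite mulf_eq0 => /orP[] /eqP; lra.
subst b2; have a0 : 0 < a2 by lra.
have LE (s t : R) : lex (a1, s) (a1, t) = (s < t) by apply: lex_eq.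
have T (s t : R) : s < t -> (s < t) = true by [].
have F (s t : R) : t <= s -> (s < t) = false by move=> ?; apply/negbTE; rewrite -leNgt.
rewrite /crossing /handle_over /half_jump /btw /reflect4 /= !LE.
have [-> ->] : (a2 < - a2) = false /\ (4 - a2 < - a2) = false.
  by split; [apply: F|apply: F]; lra.
have [-> ->] : (a2 < 4 - - a2) = true /\ (4 - a2 < 4 - - a2) = true.
  by split; [apply: T|apply: T]; lra.
have [-> ->] : (- a2 < a2) = true /\ (- a2 < 4 - a2) = true.
  by split; [apply: T|apply: T]; lra.
have [-> ->] : (4 - - a2 < a2) = false /\ (4 - - a2 < 4 - a2) = false.
  by split; [apply: F|apply: F]; lra.
have [-> ->] : (4 - - a2 < 0) = false /\ (4 - a2 < 0) = false.
  by split; [apply: F|apply: F]; lra.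
have [-> ->] : (- a2 < 0) = true /\ (a2 < 0) = false.
  by split; [apply: T|apply: F]; lra.
have [-> ->] : (4 - a2 < 4) = true /\ (4 - - a2 < 4) = false.
  by split; [apply: T|apply: F]; lra.
have [-> ->] : (- a2 < 4) = true /\ (a2 < 4) = true.
  by split; [apply: T|apply: T]; lra.
rewrite /= !andbT !andbF /= !addbF.
case: (ltrgtP x a1) => H; first by rewrite !lex_lt.
  by rewrite !lex_gt.
rewrite !lex_eq //=.
have a21 : a2 = 1 by move: ca; rewrite /on_circle /= H; nra.
by rewrite a21 !F //; lra.
Qed.

Lemma crossing_handle x a b : on_circle (x, 0) a -> on_circle (x, 0) b -> a != b ->
  crossing (handle_over x a) (handle_over x b) a (reflect4 a) b (reflect4 b) = false.
Proof.
move=> ca cb ab.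
have [_ _ a1 a2] := on_circle_bounds ca; rewrite /= in a1 a2.
have [_ _ b1 b2] := on_circle_bounds cb; rewrite /= in b1 b2.
have ne p q : p.2 != q.2 -> p != q by apply: contra => /eqP ->.
have [n1 n2 n3] : [/\ a != reflect4 b, reflect4 a != b & reflect4 a != reflect4 b].
  split; try (apply: ne => /=; apply/eqP; lra).
  by apply: contra ab => /eqP[H1 H2]; apply/eqP/injective_projections; lra.
case: (ltrgtP a.1 b.1) => H; first exact: crossing_handle_lt.
- by rewrite -crossingC // crossing_handle_lt.
- case: (ltrgtP a.2 b.2) => H2; last by case/eqP: ab; apply: injective_projections.
  + by rewrite -crossingC // crossing_handle_eq.
  + by rewrite crossing_handle_eq.
Qed.

Lemma handle_over_out x a v : (v.1 < a.1) && (v.1 < x) || (a.1 < v.1) && (x < v.1) ->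
  handle_over x a v = false.
Proof.
rewrite /handle_over /half_jump /btw => /orP[] /andP[H1 H2].
  by rewrite !lex_gt.
by rewrite !lex_lt.
Qed.

Lemma crossing_crosscap_far x x' a b : on_circle (x, 0) a -> on_circle (x', 0) b ->
  x + 4 <= x' ->
  crossing (crosscap_over a (antipode x a)) (crosscap_over b (antipode x' b))
    a (antipode x a) b (antipode x' b) = false.
Proof.
move=> /on_circle_bounds/=[? ? _ _] /on_circle_bounds/=[? ? _ _] ?.
apply: crossing_lt_x => /=; try lra.
- by apply: crosscap_over_out => /=; apply/orP; right; apply/andP; split; lra.
- by apply: crosscap_over_out => /=; apply/orP; right; apply/andP; split; lra.
- by apply: crosscap_over_out => /=; apply/orP; left; apply/andP; split; lra.
- by apply: crosscap_over_out => /=; apply/orP; left; apply/andP; split; lra.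
Qed.

Lemma crossing_handle_far x x' a b : on_circle (x, 0) a -> on_circle (x', 0) b ->
  x + 4 <= x' ->
  crossing (handle_over x a) (handle_over x' b) a (reflect4 a) b (reflect4 b) = false.
Proof.
move=> /on_circle_bounds/=[? ? _ _] /on_circle_bounds/=[? ? _ _] ?.
apply: crossing_lt_x => /=; try lra.
- by apply: handle_over_out => /=; apply/orP; right; apply/andP; split; lra.
- by apply: handle_over_out => /=; apply/orP; right; apply/andP; split; lra.
- by apply: handle_over_out => /=; apply/orP; left; apply/andP; split; lra.
- by apply: handle_over_out => /=; apply/orP; left; apply/andP; split; lra.
Qed.
End Jumps.

(** * Bilinear forms over the field with two elements, and chains of steps *)

Lemma natrF2_addb (a b : bool) : ((a (+) b)%:R = a%:R + b%:R :> 'F_2).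
Proof. by case: a; case: b; apply/eqP. Qed.

(** For an involution [sigma] this is the symmetric form given by its permutation matrix: the
    standard dot product for the identity, a hyperbolic form for a swap of coordinates. *)
Definition pairing (K : finType) (sigma : K -> K) (u v : K -> 'F_2) : 'F_2 :=
  \sum_k u k * v (sigma k).

Lemma pairingDl (K : finType) (sigma : K -> K) u u' v :
  pairing sigma (fun k => u k + u' k) v = pairing sigma u v + pairing sigma u' v.
Proof. by rewrite /pairing -big_split; apply: eq_bigr => k _; rewrite mulrDl. Qed.

Lemma pairingDr (K : finType) (sigma : K -> K) u v v' :
  pairing sigma u (fun k => v k + v' k) = pairing sigma u v + pairing sigma u v'.
Proof. by rewrite /pairing -big_split; apply: eq_bigr => k _; rewrite mulrDr. Qed.

Lemma pairing0l (K : finType) (sigma : K -> K) v :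
  pairing sigma (fun=> 0) v = 0.
Proof. by rewrite /pairing big1 // => k _; rewrite mul0r. Qed.

Lemma pairing0r (K : finType) (sigma : K -> K) v :
  pairing sigma v (fun=> 0) = 0.
Proof. by rewrite /pairing big1 // => k _; rewrite mulr0. Qed.

Lemma pairingC (K : finType) (sigma : K -> K) u v : involutive sigma ->
  pairing sigma u v = pairing sigma v u.
Proof.
move=> sK; rewrite /pairing (reindex_inj (inv_inj sK)).
by apply: eq_bigr => k _; rewrite sK mulrC.
Qed.

Section Chains.
Variables (R : realFieldType) (T : Type) (K : finType) (sigma : K -> K).
Local Notation P := (R * R)%type.
Variables (over : T -> P -> P -> P -> bool) (charge : T -> P -> P -> K -> 'F_2).

Fixpoint steps (Q : T -> P -> P -> Prop) p (s : seq (T * P)) : Prop :=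
  if s is (t, q) :: s' then Q t p q /\ steps Q q s' else True.

Definition chain_end p (s : seq (T * P)) := last p (map snd s).

Fixpoint chain_over p (s : seq (T * P)) v : bool :=
  if s is (t, q) :: s' then over t p q v (+) chain_over q s' v else false.

Fixpoint chain_charge p (s : seq (T * P)) k : 'F_2 :=
  if s is (t, q) :: s' then charge t p q k + chain_charge q s' k else 0.

Lemma crossing_cat_r (h h1 h2 : P -> bool) p q p' q' s' :
  crossing h (fun v => h1 v (+) h2 v) p q p' s' =
  crossing h h1 p q p' q' (+) crossing h h2 p q q' s'.
Proof.
rewrite /crossing.
move: (btw p q p') (btw p q q') (btw p q s') => b1 b2 b3.
case: (h1 p); case: (h1 q); case: (h2 p); case: (h2 q);
  by case: (h p'); case: (h q'); case: (h s'); case: b1; case: b2; case: b3.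
Qed.

Lemma crossing_rev_r (h h' : P -> bool) p q p' q' :
  crossing h h' p q q' p' = crossing h h' p q p' q'.
Proof. by rewrite /crossing (addbC (h q')) (addbC (btw p q q')). Qed.

(** Both sides are additive in either chain, so the identity passes from single steps to chains. *)
Lemma crossing_chain (Q Q' : T -> P -> P -> Prop) p s p' s' :
  (forall t p q t' p' q', Q t p q -> Q' t' p' q' ->
    (crossing (over t p q) (over t' p' q') p q p' q')%:R =
    pairing sigma (charge t p q) (charge t' p' q')) ->
  steps Q p s -> steps Q' p' s' ->
  (crossing (chain_over p s) (chain_over p' s') p (chain_end p s)
     p' (chain_end p' s'))%:R =
  pairing sigma (chain_charge p s) (chain_charge p' s').
Proof.
move=> HQ; elim: s p => [|[t q] s IH] p /=.
  by rewrite pairing0l /crossing /btw !addbb.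
case=> Qt Qs Qs'; rewrite (@crossing_cat _ _ (over t p q) (chain_over q s) _ _ q) //.
rewrite natrF2_addb (IH q) // pairingDl; congr (_ + _).
elim: s' p' Qs' {IH} => [|[t' q'] s' IH] p' /=.
  by rewrite pairing0r /crossing !addbb.
case=> Qt' Qs'; rewrite (@crossing_cat_r _ (over t' p' q') (chain_over q' s') _ _ _ q').
by rewrite natrF2_addb (IH q') // pairingDr HQ.
Qed.
End Chains.

(** * The intersection forms of cross-caps and handles *)

Section Models.
Variable R : realType.
Local Notation P := (R * R)%type.

(* Tag [None] marks a short step, tag [Some i] a jump through the [i]-th handle or
   cross-cap. *)
Definition step (n : nat) (D : P -> Prop) (glue : nat -> P -> P -> Prop) (e : R)
    (t : option nat) (p q : P) : Prop :=
  if t is Some i then (i < n)%N /\ (glue i p q \/ glue i q p)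
  else [/\ ~ D p, ~ D q & near_pt e p q].

(** The common interface of both kinds of surfaces. The separation [r] comes from the drawings; the
    length [e] of short steps is chosen afterwards. *)
Definition crossing_model (n : nat) (D : P -> Prop) (glue : nat -> P -> P -> Prop)
    (K : finType) (sigma : K -> K) (over : option nat -> P -> P -> P -> bool)
    (charge : option nat -> P -> P -> K -> 'F_2) : Prop :=
  forall r, 0 < r -> exists2 e, 0 < e & forall t p q t' p' q',
    step n D glue e t p q -> step n D glue e t' p' q' ->
    ~~ near_pt r p p' -> ~~ near_pt r p q' -> ~~ near_pt r q p' ->
    ~~ near_pt r q q' ->
    (crossing (over t p q) (over t' p' q') p q p' q')%:R =
    pairing sigma (charge t p q) (charge t' p' q').

Lemma centers_lt (i j : nat) : (i < j)%N -> (4 * i)%:R + 4 <= (4 * j)%:R :> R.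
Proof. by move=> ij; rewrite -natrD ler_nat; lia. Qed.

Lemma sum_jump (n i : nat) (u : 'I_n -> 'F_2) (ltin : (i < n)%N) :
  \sum_(k < n) (Some i == Some (val k))%:R * u k = u (Ordinal ltin).
Proof.
rewrite (bigD1 (Ordinal ltin)) //= eqxx mul1r big1 ?addr0 // => k ki.
rewrite (negbTE (_ : Some i != Some (val k))) ?mul0r //.
by apply: contra ki => /eqP[ik]; apply/eqP/val_inj.
Qed.

(** The charge counts jumps modulo 2. Only jumps through the same cross-cap cross, and they do so
    once: the form is the dot product of rank [c]. *)
Lemma crosscap_model (c : nat) :
  crossing_model c (fun p => exists2 i, (i < c)%N & disc ((4 * i)%:R, 0) p)
    (fun i p p' => circle ((4 * i)%:R, 0) p /\ p' = ((8 * i)%:R - p.1, - p.2))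
    (fun k : 'I_c => k)
    (fun t p q => if t is Some _ then crosscap_over p q else small_over p q)
    (fun t p q k => (t == Some (val k))%:R).
Proof.
(* The estimates for half jumps ask for [r <= 1] and [4 * e <= r ^+ 2]. *)
move=> r0 r0_gt0; pose r := Num.min r0 1; pose e := r ^+ 2 / 4.
have r_gt0 : 0 < r by rewrite lt_min r0_gt0 ltr01.
have r_le1 : r <= 1 by rewrite ge_min lexx orbT.
have r01 : 0 < r <= 1 by rewrite r_gt0.
have e_gt0 : 0 < e by rewrite divr_gt0 // exprn_gt0.
have er : 4 * e <= r ^+ 2 by rewrite /e; lra.
have er2 : 2 * e <= r by rewrite /e; nra.
exists e => //; pose D (p : P) := exists2 i, (i < c)%N & disc ((4 * i)%:R, 0) p.
have offD i (p : P) : (i < c)%N -> ~ D p -> off_disc ((4 * i)%:R, 0) p.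
  by move=> ic Dp; rewrite /off_disc leNgt; apply/negP => H; apply: Dp; exists i.
have jump i (p q : P) : circle ((4 * i)%:R, 0) p /\ q = ((8 * i)%:R - p.1, - p.2) \/
    circle ((4 * i)%:R, 0) q /\ p = ((8 * i)%:R - q.1, - q.2) ->
    on_circle ((4 * i)%:R, 0) p /\ q = antipode (4 * i)%:R p.
  have E v : ((8 * i)%:R - v.1, - v.2) = antipode (4 * i)%:R v :> P.
    by rewrite /antipode -natrM mulnA.
  case=> -[cp ->]; first by split=> //; exact: E.
  have -> := E q.
  split; first exact: (antipode_circle cp).
  by case: q cp => q1 q2 _; rewrite /antipode /=; congr pair; ring.
move=> t p q t' p' q' St St' N1 N2 N3 N4.
have ap (x y : P) : ~~ near_pt r0 x y -> ~~ near_pt r x y.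
  by apply: contra; apply: near_ptW; rewrite /r ge_min lexx.
have {}N1 := ap _ _ N1; have {}N2 := ap _ _ N2.
have {}N3 := ap _ _ N3; have {}N4 := ap _ _ N4.
have := apart_neq r_gt0 N1; have := apart_neq r_gt0 N2.
have := apart_neq r_gt0 N3; have := apart_neq r_gt0 N4 => M4 M3 M2 M1.
case: t t' St St' => [i|] [j|] /=.
- move=> [ic /jump[cp Eq]] [jc /jump[cp' Eq']]; subst q q'.
  rewrite /pairing sum_jump.
  case: (ltngtP i j) => ij.
  + by rewrite crossing_crosscap_far ?centers_lt // eqE /= (gtn_eqF ij).
  + by rewrite -crossingC // crossing_crosscap_far ?centers_lt // eqE /= (ltn_eqF ij).
  + by subst j; rewrite crossing_crosscap // eqxx.
- move=> [ic /jump[cp Eq]] [D1 D2 n]; subst q.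
  rewrite [RHS]big1; last by move=> k _; rewrite mulr0.
  by rewrite (crossing_crosscap_small e_gt0 er r01) //; apply: offD.
- move=> [D1 D2 n] [ic /jump[cp Eq]]; subst q'.
  rewrite [RHS]big1; last by move=> k _; rewrite mul0r.
  rewrite -crossingC // (crossing_crosscap_small e_gt0 er r01) //;
    by [apply: offD | rewrite near_ptC].
- move=> [D1 D2 n] [D1' D2' n'].
  rewrite [RHS]big1; last by move=> k _; rewrite mul0r.
  by rewrite (crossing_small e_gt0 er2).
Qed.

(** Coordinate [(i, true)] counts jumps through handle [i], and [(i, false)] counts short steps
    across its corridor. Jumps do not cross each other but cross corridor steps, so [sigma] swaps
    the two. The conditional picks the end of a jump on the lower circle. *)
Lemma handle_model (h : nat) :
  crossing_model h
    (fun p => exists2 i, (i < h)%N &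
       disc ((4 * i)%:R, 0) p \/ disc ((4 * i)%:R, 4) p)
    (fun i p p' => circle ((4 * i)%:R, 0) p /\ p' = (p.1, 4 - p.2))
    (fun k : 'I_h * bool => (k.1, ~~ k.2))
    (fun t p q => if t is Some i then
       handle_over (4 * i)%:R (if p.2 < q.2 then p else q) else small_over p q)
    (fun t p q k => (if k.2 then t == Some (val k.1) else
       (t == None) && corridor (4 * val k.1)%:R p q)%:R).
Proof.
move=> r0 r0_gt0; pose r := Num.min r0 1; pose e := r ^+ 2 / 4.
have r_gt0 : 0 < r by rewrite lt_min r0_gt0 ltr01.
have r_le1 : r <= 1 by rewrite ge_min lexx orbT.
have r01 : 0 < r <= 1 by rewrite r_gt0.
have e_gt0 : 0 < e by rewrite divr_gt0 // exprn_gt0.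
have er : 4 * e <= r ^+ 2 by rewrite /e; lra.
have er2 : 2 * e <= r by rewrite /e; nra.
exists e => //; pose D (p : P) := exists2 i, (i < h)%N &
  disc ((4 * i)%:R, 0) p \/ disc ((4 * i)%:R, 4) p.
have offD i (p : P) : (i < h)%N -> ~ D p ->
    off_disc ((4 * i)%:R, 0) p /\ off_disc ((4 * i)%:R, 4) p.
  move=> ih Dp; rewrite /off_disc !leNgt.
  by split; apply/negP => H; apply: Dp; exists i => //; [left|right].
have jump i (p q : P) (a := if p.2 < q.2 then p else q) :
    circle ((4 * i)%:R, 0) p /\ q = (p.1, 4 - p.2) \/
    circle ((4 * i)%:R, 0) q /\ p = (q.1, 4 - q.2) ->
    on_circle ((4 * i)%:R, 0) a /\
    ((p, q) = (a, reflect4 a) \/ (p, q) = (reflect4 a, a)).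
  rewrite /a; case=> -[cp ->] /=; have [_ _ _ hy] := on_circle_bounds cp;
    rewrite /= in hy.
    by rewrite (_ : _ < _ = true); [split=> //; left | apply/idP; lra].
  rewrite (_ : _ < _ = false); first by split=> //; right.
  by apply/negbTE; rewrite -leNgt; lra.
have pairE u v : pairing (fun k : 'I_h * bool => (k.1, ~~ k.2)) u v =
    \sum_(i < h) (u (i, true) * v (i, false) + u (i, false) * v (i, true)).
  rewrite /pairing (eq_bigr (fun k => u (k.1, k.2) * v (k.1, ~~ k.2))); last by case.
  rewrite -(pair_bigA _ (fun i b => u (i, b) * v (i, ~~ b))) /=.
  by apply: eq_bigr => i _; rewrite big_bool.
move=> t p q t' p' q' St St' N1 N2 N3 N4.
have ap (x y : P) : ~~ near_pt r0 x y -> ~~ near_pt r x y.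
  by apply: contra; apply: near_ptW; rewrite /r ge_min lexx.
have {}N1 := ap _ _ N1; have {}N2 := ap _ _ N2.
have {}N3 := ap _ _ N3; have {}N4 := ap _ _ N4.
have := apart_neq r_gt0 N1; have := apart_neq r_gt0 N2.
have := apart_neq r_gt0 N3; have := apart_neq r_gt0 N4 => M4 M3 M2 M1.
rewrite pairE.
have JS i a (c d : P) : (i < h)%N -> ~ D c -> ~ D d -> near_pt e c d ->
    on_circle ((4 * i)%:R, 0) a -> ~~ near_pt r a c -> ~~ near_pt r a d ->
    ~~ near_pt r (reflect4 a) c -> ~~ near_pt r (reflect4 a) d ->
    crossing (handle_over (4 * i)%:R a) (small_over c d) a (reflect4 a) c d
    = corridor (4 * i)%:R c d.
  move=> ih Dc Dd cd ca *; have [? ?] := offD _ _ ih Dc; have [? ?] := offD _ _ ih Dd.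
  exact: (crossing_handle_small e_gt0 er r01).
case: t t' St St' => [i|] [j|] /=.
- move=> [ih /jump]; move: (if p.2 < q.2 then p else q) => a [ca Ea].
  move=> [jh /jump]; move: (if p'.2 < q'.2 then p' else q') => b [cb Eb].
  rewrite [RHS]big1; last by move=> k _; rewrite mulr0 mul0r addr0.
  have -> : crossing (handle_over (4 * i)%:R a) (handle_over (4 * j)%:R b) p q p' q'
     = crossing (handle_over (4 * i)%:R a) (handle_over (4 * j)%:R b)
         a (reflect4 a) b (reflect4 b).
    case: Ea => -[-> ->]; case: Eb => -[-> ->] //; first by rewrite [LHS]crossing_rev_r.
      by rewrite [LHS]crossing_rev.
    by rewrite [LHS]crossing_rev [LHS]crossing_rev_r.
  have [n1 n2 n3 n4] : [/\ a != b, a != reflect4 b, reflect4 a != b &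
      reflect4 a != reflect4 b].
    by case: Ea => -[Ep Eq]; case: Eb => -[Ep' Eq']; subst p q p' q'.
  case: (ltngtP i j) => ij.
  + by rewrite crossing_handle_far ?centers_lt.
  + by rewrite -crossingC // crossing_handle_far ?centers_lt.
  + by subst j; rewrite crossing_handle.
- move=> [ih /jump]; move: (if p.2 < q.2 then p else q) => a [ca Ea].
  move=> [D1 D2 n].
  rewrite (eq_bigr (fun k : 'I_h => (Some i == Some (val k))%:R *
    (corridor (4 * val k)%:R p' q')%:R)); last by move=> k _; rewrite mul0r addr0.
  rewrite (sum_jump (fun k => (corridor (4 * val k)%:R p' q')%:R) ih) /=; congr (_ %:R).
  case: Ea => -[Ep Eq]; subst p q; first by rewrite JS.
  by rewrite crossing_rev JS.
- move=> [D1 D2 n] [ih /jump]; move: (if p'.2 < q'.2 then p' else q') => a [ca Ea].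
  rewrite (eq_bigr (fun k : 'I_h => (Some j == Some (val k))%:R *
    (corridor (4 * val k)%:R p q)%:R)); last by move=> k _; rewrite mul0r add0r mulrC.
  rewrite (sum_jump (fun k => (corridor (4 * val k)%:R p q)%:R) ih) /=; congr (_ %:R).
  by case: Ea => -[Ep Eq]; subst p' q'; rewrite -crossingC //;
    [|rewrite crossing_rev]; rewrite JS // near_ptC.
- move=> [D1 D2 n] [D1' D2' n'].
  rewrite [RHS]big1; last by move=> k _; rewrite mul0r mulr0 addr0.
  by rewrite (crossing_small e_gt0 er2).
Qed.

End Models.

Local Open Scope classical_set_scope.
Local Open Scope ring_scope.

(** * Lifting continua from the surface to the plane *)

Section Lifting.
Variable R : realType.
Local Notation P := (R * R)%type.

Lemma near_pt_ball (e : R) (p q : P) : ball p e q <-> near_pt e p q.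
Proof. by split=> [[? ?]|/andP[? ?]]; [apply/andP|]; split. Qed.

Lemma disc_open (a : P) : open (disc a).
Proof.
have fc : continuous (fun p : P => (p.1 - a.1) ^+ 2 + (p.2 - a.2) ^+ 2).
  move=> p; apply: cvgD; rewrite !expr2.
    by apply: cvgM; apply: cvgB; solve [exact: cvg_fst | exact: cvg_cst].
  by apply: cvgM; apply: cvgB; solve [exact: cvg_snd | exact: cvg_cst].
rewrite (_ : disc a = (fun p : P => (p.1 - a.1) ^+ 2 + (p.2 - a.2) ^+ 2) @^-1`
  [set x | x < 1]) //.
by apply: open_comp; [move=> ? _; exact: fc|exact: open_lt].
Qed.

(** The set of differences is compact and misses 0, hence misses a ball about 0. *)
Lemma compact_apart (A B : set P) : compact A -> compact B -> A `&` B = set0 ->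
  exists2 r, 0 < r & forall a b, A a -> B b -> ~~ near_pt r a b.
Proof.
move=> cA cB AB0.
pose d (z : P * P) : P := z.1 - z.2.
have dc : continuous d.
  by move=> z; apply: (@cvgB _ (P : normedModType R)); [exact: cvg_fst|exact: cvg_snd].
have cD : compact (d @` (A `*` B)).
  by apply: continuous_compact; [exact: continuous_subspaceT|exact: compact_setX].
have hP : hausdorff_space P by exact: norm_hausdorff.
have oD := closed_openC (compact_closed hP cD).
have D0 : (~` (d @` (A `*` B))) 0.
  move=> [[a b] /= [Aa Bb]] [/eqP + /eqP]; rewrite !subr_eq0 => /eqP E1 /eqP E2.
  have ab : a = b by apply: injective_projections.
  by have : (A `&` B) a; [split => //; rewrite ab|rewrite AB0].
have /nbhs_ballP[r /= r0 Hr] := open_nbhs_nbhs (conj oD D0).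
exists r => // a b Aa Bb; apply/negP => ab.
apply: (Hr (d (a, b))); last by exists (a, b).
by apply/near_pt_ball; move: ab; rewrite /near_pt /= !sub0r !normrN.
Qed.

Variables (M : topologicalType) (n : nat) (D : set P) (glue : nat -> P -> P -> Prop).
Variable f : sphere R -> M.
Let K : set (sphere R) := ~` (Some @` D).
Hypotheses (hM : hausdorff_space M) (oD : open D).
Hypothesis fc : {within K, continuous f}.
Hypothesis fs : forall m : M, exists2 x, K x & f x = m.
Hypothesis fg : forall p q : P, ~ D p -> ~ D q -> f (Some p) = f (Some q) ->
  p = q \/ exists2 i, (i < n)%N & glue i p q \/ glue i q p.

Definition lift_set (X : set M) : set P := [set p | ~ D p /\ X (f (Some p))].

Let K_Some p : ~ D p -> K (Some p).
Proof. by move=> Dp [q Dq [qp]]; apply: Dp; rewrite -qp. Qed.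

Let Some_K p : K (Some p) -> ~ D p.
Proof. by move=> Kp Dp; apply: Kp; exists p. Qed.

(** The preimage of [X] is closed and avoids a neighbourhood of the point at infinity, so it lies in
    a compact set of the plane. *)
Lemma lift_compact X : compact X -> ~ X (f None) -> compact (lift_set X).
Proof.
move=> cX Xinf; have clX := compact_closed hM cX.
have clK : closed K.
  by apply: open_closedC; exact: one_point_compactification_open_some.
have clL : closed (K `&` f @^-1` X).
  have /continuous_closedP/(_ _ clX)/closed_subspaceP[B clB BK] := fc.
  by rewrite setIC -BK; apply: closedI.
have NL : nbhs (None : sphere R) (~` (K `&` f @^-1` X)).
  apply: open_nbhs_nbhs; split; first exact: closed_openC.
  by case=> _; exact: Xinf.
have [C [cC _] HC] := NL.
have LC : lift_set X `<=` C.
  move=> p [Dp Xp]; apply: contrapT => Cp.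
  by apply: (HC (Some p)); [left; exists p | split => //; exact: K_Some].
have -> : lift_set X = (Some : P -> sphere R) @^-1` (K `&` f @^-1` X).
  by apply/seteqP; split=> p [? ?]; split => //; [exact: K_Some|exact: Some_K].
apply: (subclosed_compact _ cC); last first.
  by move=> p [Kp Xp]; apply: LC; split => //; exact: Some_K.
by apply: preimage_closed => // x _; exact: one_point_compactification_some_continuous.
Qed.

Lemma lift_point X m : X m -> ~ X (f None) -> exists2 p, lift_set X p & f (Some p) = m.
Proof.
move=> Xm Xinf; have [[p|] Kx fx] := fs m; last by rewrite fx in Xinf.
by exists p => //; split; [exact: Some_K|rewrite fx].
Qed.

Lemma lift_image_closed X (U : set P) : U `<=` lift_set X -> compact U ->
  closed (f @` (Some @` U)).
Proof.
move=> UX cU; apply: compact_closed => //.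
apply: (@continuous_compact (sphere R) M f (Some @` U)).
  apply: continuous_subspaceW fc => _ [p Up <-]; apply: K_Some.
  by have [] := UX _ Up.
apply: (@continuous_compact P (sphere R) Some U) => //.
by apply: continuous_subspaceT; exact: one_point_compactification_some_continuous.
Qed.

Definition lift_step X e t p q :=
  [/\ step n D glue e t p q, lift_set X p & lift_set X q].

Lemma steps_rcons (T : Type) (Q : T -> P -> P -> Prop) p s t q :
  steps Q p (rcons s (t, q)) <-> steps Q p s /\ Q t (chain_end p s) q.
Proof.
elim: s p => [|[t' q'] s IH] p /=; first by tauto.
by rewrite IH /chain_end /=; tauto.
Qed.

(** The points of the lift reachable from [p] and the remaining ones form two compact sets, since
    short steps are available. Their images are disjoint, since jumps are available, and cover the
    connected set [X]. *)
Lemma lift_chain X e p q : compact X -> connected X -> ~ X (f None) -> 0 < e ->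
  lift_set X p -> lift_set X q ->
  exists2 s, steps (lift_step X e) p s & chain_end p s = q.
Proof.
move=> cX coX Xinf e0 Lp Lq.
have cL := lift_compact cX Xinf.
have hP : hausdorff_space P by exact: norm_hausdorff.
have clL := compact_closed hP cL.
pose U := [set x | lift_set X x /\
  exists2 s, steps (lift_step X e) p s & chain_end p s = x].
have stepU t x y : U x -> lift_set X y -> step n D glue e t x y -> U y.
  move=> [Lx [s Ss Es]] Ly xy; split => //; exists (rcons s (t, y)).
    by apply/steps_rcons; split => //; rewrite Es.
  by rewrite /chain_end map_rcons last_rcons.
have smallU x y : U x -> lift_set X y -> near_pt e x y -> U y.
  move=> Ux Ly xy; apply: (stepU None x) => //; split => //; first by case: Ux => -[].
  by case: Ly.
have nearU (Z : set P) x : closure Z x -> exists2 y, Z y & near_pt e x y.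
  move=> /(_ (ball x e)) []; first exact: nbhsx_ballx.
  by move=> y [Zy /near_pt_ball xy]; exists y.
have clU : closed U.
  move=> x cx; have Lx : lift_set X x by apply: clL; apply: closure_subset cx => y [].
  have [y Uy xy] := nearU _ _ cx.
  by apply: (smallU y) => //; rewrite near_ptC.
have clV : closed (lift_set X `\` U).
  move=> x cx; have Lx : lift_set X x by apply: clL; apply: closure_subset cx => y [].
  split => // Ux; have [y [Ly nUy] xy] := nearU _ _ cx.
  by apply: nUy; apply: (smallU x).
have cU : compact U by apply: (subclosed_compact clU cL) => x [].
have cV : compact (lift_set X `\` U) by apply: (subclosed_compact clV cL) => x [].
have fU := @lift_image_closed X U (fun x h => h.1) cU.
have fV := @lift_image_closed X (lift_set X `\` U) (fun x h => h.1) cV.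
have disj x y : U x -> lift_set X y -> f (Some x) = f (Some y) -> U y.
  move=> Ux Ly fxy; have [Dx Dy] : ~ D x /\ ~ D y by case: Ux => -[? _] _; case: Ly.
  case: (fg Dx Dy fxy) => [<- //|[i ltin gi]].
  exact: (stepU (Some i) x).
have EX : f @` (Some @` U) = X.
  apply: coX.
  - exists (f (Some p)); exists (Some p) => //; exists p => //.
    by split => //; exists [::].
  - exists (~` (f @` (Some @` (lift_set X `\` U)))); first exact: closed_openC.
    apply/seteqP; split => m.
      move=> [_ [x Ux <-] <-]; split; first by case: Ux => -[].
      by move=> [_ [y [Ly nUy] <-] E]; apply: nUy; apply: (disj x) => //.
    move=> [Xm nV]; have [x Lx fx] := lift_point Xm Xinf.
    exists (Some x) => //; exists x => //; apply: contrapT => nUx.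
    by apply: nV; exists (Some x) => //; exists x.
  - exists (f @` (Some @` U)) => //.
    apply/seteqP; split => m; last by case.
    by move=> Um; split => //; case: Um => [_ [x Ux <-] <-]; case: Ux => -[].
have : (f @` (Some @` U)) (f (Some q)) by rewrite EX; case: Lq.
by case=> [_ [x Ux <-] fxq]; have [] := disj _ _ Ux Lq fxq.
Qed.
End Lifting.

Lemma uniform_positive (R : realType) (X : finType) (Q : X -> R -> Prop) :
  (forall x r r', r' <= r -> Q x r -> Q x r') ->
  (forall x, exists2 r, 0 < r & Q x r) -> exists2 r, 0 < r & forall x, Q x r.
Proof.
move=> Qdown HQ.
have [r_ Hr] : {r_ : X -> R & forall x, 0 < r_ x /\ Q x (r_ x)}.
  by apply: (@choice _ _ (fun x r => 0 < r /\ Q x r)) => x; have [r] := HQ x; exists r.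
exists (\big[Num.min/1]_x r_ x).
  by apply/bigmin_gtP; split=> // x _; have [] := Hr x.
by move=> x; apply: (Qdown x (r_ x)); [exact: bigmin_le|have [] := Hr x].
Qed.

(** Supplies the independent edges [ik] and [jl] that separate vertices [i] and [j] of a drawing. *)
Lemma two_others (i j : nat) (w := [seq k <- iota 0 5 | (k != i) && (k != j)])
    (k := nth 0%N w 0) (l := nth 0%N w 1) : (i < 5)%N -> (j < 5)%N -> i != j ->
  [/\ (k < 5)%N, (l < 5)%N & uniq [:: i; j; k; l]].
Proof.
rewrite {}/k {}/l {}/w; case: i => [|[|[|[|[|i]]]]] //;
  by case: j => [|[|[|[|[|j]]]]].
Qed.

(** * Bounding the number of disjoint weak drawings of [K_5] *)

Section WeakK5.
Variables (R : realType) (M : topologicalType) (n : nat).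
Local Notation P := (R * R)%type.
Variables (D : set P) (glue : nat -> P -> P -> Prop) (f : sphere R -> M).
Variables (K : finType) (sigma : K -> K).
Variables (over : option nat -> P -> P -> P -> bool).
Variables (charge : option nat -> P -> P -> K -> 'F_2).
Hypotheses (hM : hausdorff_space M) (oD : open D).
Hypothesis fc : {within (~` (Some @` D) : set (sphere R)), continuous f}.
Hypothesis fs : forall m : M, exists2 x, (~` (Some @` D)) x & f x = m.
Hypothesis fg : forall p q : P, ~ D p -> ~ D q -> f (Some p) = f (Some q) ->
  p = q \/ exists2 i, (i < n)%N & glue i p q \/ glue i q p.
Hypothesis sK : involutive sigma.
Hypothesis model : crossing_model n D glue sigma over charge.

(* A drawing of [K_5] by continua, in which only edges without common end need be
   disjoint. *)
Definition weak_K5s (I : finType) (z : I -> nat -> M)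
    (Gam : I -> nat -> nat -> set M) :=
  [/\ forall s i j, (i < j < 5)%N -> compact (Gam s i j) /\ connected (Gam s i j),
      forall s i j, (i < j < 5)%N -> Gam s i j (z s i) /\ Gam s i j (z s j),
      forall s t i j k l, (i < j < 5)%N -> (k < l < 5)%N -> s != t ->
        Gam s i j `&` Gam t k l = set0 &
      forall s i j k l, (i < j < 5)%N -> (k < l < 5)%N -> uniq [:: i; j; k; l] ->
        Gam s i j `&` Gam s k l = set0].

Lemma F2_neq0 (x : 'F_2) : x != 0 -> x = 1.
Proof. by case: x => -[|[|x]] // ltx _; apply: val_inj. Qed.

(** Edges are lifted to chains with charges [Y]. In each drawing [K5_form_sum] yields two triangles
    with pairing 1, while triangles of different drawings pair to 0; such dual families have at most
    [#|K|] members. *)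
Lemma weak_K5s_planar_bound (I : finType) (z : I -> nat -> M)
    (Gam : I -> nat -> nat -> set M) : weak_K5s z Gam ->
  (forall s i j, (i < j < 5)%N -> ~ Gam s i j (f None)) -> (#|I| <= #|K|)%N.
Proof.
case=> Gc Gz Gst Gs Ginf.
have [p_ Hp] : {p : I * nat -> P & forall x, (x.2 < 5)%N ->
    ~ D (p x) /\ f (Some (p x)) = z x.1 x.2}.
  apply: (@choice _ _ (fun (x : I * nat) (p : P) => (x.2 < 5)%N ->
    ~ D p /\ f (Some p) = z x.1 x.2)) => -[s i] /=.
  have [i5|] := ltnP i 5; last by exists 0.
  have [X [Xz Xinf]] : exists X : set M, X (z s i) /\ ~ X (f None).
    case: i i5 => [|i] i5.
      by exists (Gam s 0%N 1%N); split; [case: (Gz s 0%N 1%N)|exact: Ginf].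
    by exists (Gam s 0%N i.+1); split; [case: (Gz s 0%N i.+1)|exact: Ginf].
  by have [p [Dp _] fp] := lift_point fs Xz Xinf; exists p.
pose p s i := p_ (s, i).
(* One separation serves all disjoint pairs of lifted edges, as there are finitely many. *)
have [r r0 Hr] : exists2 r : R, 0 < r &
    forall x : (I * 'I_5 * 'I_5) * (I * 'I_5 * 'I_5),
    let: (s, i, j, (t, k, l)) := x in
    (i < j)%N -> (k < l)%N -> Gam s i j `&` Gam t k l = set0 ->
    forall a b, lift_set D f (Gam s i j) a -> lift_set D f (Gam t k l) b ->
      ~~ near_pt r a b.
  apply: uniform_positive.
    move=> [[[s i] j] [[t k] l]] r r' rr' H ij kl E a b La Lb.
    by apply: contra (H ij kl E a b La Lb); exact: near_ptW.
  move=> [[[s i] j] [[t k] l]].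
  have [ij|] := boolP (i < j)%N; last by exists 1.
  have [kl|] := boolP (k < l)%N; last by exists 1.
  have [E|] := pselect (Gam s i j `&` Gam t k l = set0); last by exists 1.
  have ij5 : (i < j < 5)%N by rewrite ij ltn_ord.
  have kl5 : (k < l < 5)%N by rewrite kl ltn_ord.
  have cA := lift_compact hM oD fc (Gc s i j ij5).1 (Ginf s i j ij5).
  have cB := lift_compact hM oD fc (Gc t k l kl5).1 (Ginf t k l kl5).
  have [|r r0 Hr] := compact_apart cA cB; last by exists r.
  apply/seteqP; split=> // x [[_ A] [_ B]].
  by have : (Gam s i j `&` Gam t k l) (f (Some x)) by []; rewrite E.
have [e e0 He] := model r0.
have [c_ Hc] : {c : I * nat * nat -> seq (option nat * P) & forall x,
    (x.1.2 < x.2 < 5)%N ->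
    steps (lift_step n D glue f (Gam x.1.1 x.1.2 x.2) e) (p x.1.1 x.1.2) (c x) /\
    chain_end (p x.1.1 x.1.2) (c x) = p x.1.1 x.2}.
  apply: (@choice _ _ (fun (x : I * nat * nat) c => (x.1.2 < x.2 < 5)%N ->
    steps (lift_step n D glue f (Gam x.1.1 x.1.2 x.2) e) (p x.1.1 x.1.2) c /\
    chain_end (p x.1.1 x.1.2) c = p x.1.1 x.2)) => -[[s i] j] /=.
  have [ij|] := boolP (i < j < 5)%N; last by exists [::].
  have [Gi Gj] := Gz s i j ij; have /andP[ltij j5] := ij.
  have [Di fi] := Hp (s, i) (ltn_trans ltij j5); have [Dj fj] := Hp (s, j) j5.
  have [||w Hw Ew] := lift_chain hM oD fc fs fg (Gc s i j ij).1 (Gc s i j ij).2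
    (Ginf s i j ij) e0 (p := p s i) (q := p s j).
  - by split=> //; rewrite fi.
  - by split=> //; rewrite fj.
  - by exists w.
pose c s i j := c_ (s, i, j).
pose Y s i j : K -> 'F_2 := chain_charge charge (p s i) (c s i j).
pose H s i j t k : 'F_2 := (chain_over over (p s i) (c s i j) (p t k))%:R.
pose L s i t k : 'F_2 := (lex (p s i) (p t k))%:R.
have HX s t i j k l : (i < j < 5)%N -> (k < l < 5)%N ->
    Gam s i j `&` Gam t k l = set0 ->
    pairing sigma (Y s i j) (Y t k l) = H s i j t k + H s i j t l
      + H t k l s i + H t k l s j + (L s i t k + L s i t l + L s j t k + L s j t l).
  move=> ij kl E; have [S1 E1] := Hc (s, i, j) ij; have [S2 E2] := Hc (t, k, l) kl.
  rewrite /Y -(crossing_chain (over := over) _ S1 S2) /=; last first.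
    move=> t1 p1 q1 t2 p2 q2 [s1 lp1 lq1] [s2 lp2 lq2].
    have /andP[ltij j5] := ij; have /andP[ltkl l5] := kl.
    have apt a b : lift_set D f (Gam s i j) a -> lift_set D f (Gam t k l) b ->
        ~~ near_pt r a b.
      exact: (Hr (s, Ordinal (ltn_trans ltij j5), Ordinal j5,
        (t, Ordinal (ltn_trans ltkl l5), Ordinal l5))).
    by apply: He => //; apply: apt.
  rewrite /= in E1 E2; rewrite E1 E2 /crossing /btw !natrF2_addb /H /L /c; ring.
have F2 : 1 + 1 = 0 :> 'F_2 by apply/eqP.
have bDl (u v w : K -> 'F_2) :
    pairing sigma (u + v) w = pairing sigma u w + pairing sigma v w.
  exact: pairingDl.
have bC (u v : K -> 'F_2) : pairing sigma u v = pairing sigma v u := pairingC u v sK.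
pose T s i j : K -> 'F_2 := Y s 0%N i + Y s i j + Y s 0%N j.
(* Coinciding vertices [i] and [j] would be a common point of the independent edges [ik] and
   [jl]. *)
have pinj s i j : (i < 5)%N -> (j < 5)%N -> i != j -> p s i != p s j.
  move=> i5 j5 ij; apply/negP => /eqP E.
  have [_ fi] := Hp (s, i) i5; have [_ fj] := Hp (s, j) j5.
  have zij : z s i = z s j by rewrite -[LHS]fi -[RHS]fj -/(p s i) E.
  have [k5 l5] := two_others i5 j5 ij.
  move: (nth _ _ 0) (nth _ _ 1) k5 l5 => k l k5 l5 ijkl.
  have Gij a b : (a < 5)%N -> (b < 5)%N -> a != b ->
      exists2 u : nat * nat, (u.1 < u.2 < 5)%N /\ perm_eq [:: u.1; u.2] [:: a; b] &
        Gam s u.1 u.2 (z s a).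
    move=> a5 b5; rewrite neq_ltn => /orP[] ltab.
      by exists (a, b); [rewrite /= ltab|have [] := Gz s a b _; rewrite ?ltab].
    exists (b, a); last by have [] := Gz s b a _; rewrite ?ltab.
    by split; [rewrite /= ltab|rewrite /= (perm_catC [:: b] [:: a])].
  have ik : i != k by move: ijkl; rewrite /= !inE; do !case: eqP.
  have jl : j != l by move: ijkl; rewrite /= !inE; do !case: eqP.
  have [[a b] [/= ab Pab] Ga] := Gij _ _ i5 k5 ik.
  have [[a' b'] [/= ab' Pab'] Ga'] := Gij _ _ j5 l5 jl.
  have : (Gam s a b `&` Gam s a' b') (z s i) by split=> //; rewrite zij.
  rewrite (Gs s a b a' b') //.
  rewrite (perm_uniq (_ : perm_eq _ ([:: i; k] ++ [:: j; l]))); last first.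
    exact: (perm_cat Pab Pab').
  by move: ijkl; rewrite /= !inE; do !case: eqP => // ?; subst.
have HK5 s : exists2 x : nat * nat * nat * nat, let: (i, j, k, l) := x in
    [/\ (0 < i < j)%N, (j < 5)%N, (0 < k < l)%N & (l < 5)%N] &
    let: (i, j, k, l) := x in pairing sigma (T s i j) (T s k l) = 1.
  have : pairing sigma (T s 1%N 2%N) (T s 3%N 4%N)
      + pairing sigma (T s 1%N 3%N) (T s 2%N 4%N)
      + pairing sigma (T s 1%N 4%N) (T s 2%N 3%N) = 1.
    apply: (K5_form_sum F2 bDl bC (H := fun i j k => H s i j s k)
      (L := fun i j => L s i s j)) => [i j i5 j5 ij|i j k l ij kl u].
      by rewrite /L (lexN (pinj s i j i5 j5 ij)); case: lex; apply/eqP.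
    by rewrite HX //; exact: Gs.
  have [->|/F2_neq0 E1 _] := eqVneq (pairing sigma (T s 1%N 2%N) (T s 3%N 4%N)) 0;
    last by exists (1, 2, 3, 4)%N.
  have [->|/F2_neq0 E2 _] := eqVneq (pairing sigma (T s 1%N 3%N) (T s 2%N 4%N)) 0;
    last by exists (1, 3, 2, 4)%N.
  by rewrite !add0r => E3; exists (1, 4, 2, 3)%N.
have [x_ Hx] : {x_ : I -> nat * nat * nat * nat & forall s, let: (i, j, k, l) := x_ s in
    [/\ (0 < i < j)%N, (j < 5)%N, (0 < k < l)%N, (l < 5)%N &
     pairing sigma (T s i j) (T s k l) = 1]}.
  apply: (@choice _ _ (fun s (x : nat * nat * nat * nat) => let: (i, j, k, l) := x in
    [/\ (0 < i < j)%N, (j < 5)%N, (0 < k < l)%N, (l < 5)%N &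
     pairing sigma (T s i j) (T s k l) = 1])) => s.
  have [[[[i j] k] l] [? ? ? ?] ?] := HK5 s.
  by exists (i, j, k, l).
apply: (@dual_families_bound _ I K (fun s => let: (i, j, _, _) := x_ s in T s i j)
  (fun s a => let: (_, _, k, l) := x_ s in T s k l (sigma a))) => s t.
have [E|st] := eqVneq s t.
  by subst t; have := Hx s; case: (x_ s) => [[[i j] k] l] [].
have := Hx s; have := Hx t; case: (x_ s) => [[[i j] k] l].
case: (x_ t) => [[[i' j'] k'] l'] [_ _ k'l' l'5 _] [ij j5 _ _ _].
by apply: (triangle_form_eq0 F2 bDl bC (H := fun i j k => H s i j t k)
  (H' := fun i j k => H t i j s k) (L := fun i k => L s i t k)) => // a b a' b' ab ab';
  rewrite HX //; exact: Gst.
Qed.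

(** Different drawings are disjoint, so at most one contains the image of the point at infinity; it
    accounts for the extra 1. *)
Lemma weak_K5s_bound (I : finType) (z : I -> nat -> M)
    (Gam : I -> nat -> nat -> set M) : weak_K5s z Gam -> (#|I| <= #|K|.+1)%N.
Proof.
move=> HI; pose bad (s : I) : bool :=
  `[< exists i j, (i < j < 5)%N /\ Gam s i j (f None) >].
have bad1 s t : bad s -> bad t -> s = t.
  move=> /asboolP[i [j [ij Gij]]] /asboolP[k [l [kl Gkl]]].
  apply/eqP/negPn/negP => st; case: HI => _ _ /(_ s t i j k l ij kl st) + _.
  by move/seteqP => [/(_ (f None)) H _]; apply: H.
pose J := {s : I | ~~ bad s}.
have : (#|{: J}| <= #|K|)%N.
  apply: (@weak_K5s_planar_bound _ (fun s : J => z (val s)) (fun s : J => Gam (val s))).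
    case: HI => H1 H2 H3 H4; split=> [s|s|s t|s].
    - exact: H1.
    - exact: H2.
    - by move=> i j k l ij kl st; apply: H3.
    - exact: H4.
  move=> [s /= bs] i j ij Gij; move/negP: bs; apply; apply/asboolP.
  by exists i, j.
rewrite card_sig => JK.
have b1 : (#|bad| <= 1)%N by apply/card_le1_eqP => s t bs bt; apply: bad1.
by rewrite -(cardC bad); apply: leq_add b1 JK.
Qed.
End WeakK5.

(** * The theorem *)

Lemma glued_sphere_weak_K5s (R : realType) (M : topologicalType) (n : nat)
    (D : set (R * R)) (glue : nat -> R * R -> R * R -> Prop) (K : finType)
    (sigma : K -> K) over charge (I : finType) (z : I -> nat -> M) Gam :
  hausdorff_space M -> open D -> involutive sigma ->
  crossing_model n D glue sigma over charge ->
  glued_sphere D (fun p p' => exists2 i, (i < n)%N & glue i p p') M ->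
  weak_K5s z Gam -> (#|I| <= #|K|.+1)%N.
Proof.
move=> hM oD sK model [q [qc qs qg]].
apply: (@weak_K5s_bound R M n D glue q K sigma over charge hM oD qc qs _ sK model).
move=> p p' Dp Dp' E.
have KS x : ~ D x -> (~` (Some @` D) : set (sphere R)) (Some x).
  by move=> Dx [y Dy [yx]]; apply: Dx; rewrite -yx.
have /(qg _ _ (KS _ Dp) (KS _ Dp'))[[->]|] := E; first by left.
move=> [a [a' [[->] [->] H]]]; right.
by case: H => -[i ltin gi]; exists i => //; [left|right].
Qed.

(** The form has [2 * h] coordinates for [h] handles and [c] for [c] cross-caps, in both cases the
    Euler genus. *)
Lemma euler_genus_weak_K5s (R : realType) (M : topologicalType) (g : nat)
    (I : finType) (z : I -> nat -> M) Gam :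
  surface R M -> euler_genus R M g -> weak_K5s z Gam -> (#|I| <= g.+1)%N.
Proof.
move=> [[hM _ _] _ _] Hg HI.
have open_union (n : nat) (A : nat -> set (R * R)) : (forall i, open (A i)) ->
    open [set p | exists2 i, (i < n)%N & A i p].
  move=> oA; have -> : [set p | exists2 i, (i < n)%N & A i p] =
      \bigcup_(i in [set i | (i < n)%N]) A i.
    by apply/seteqP; split=> p [i ? ?]; exists i.
  by apply: bigcup_open => i _; exact: oA.
case: Hg => [[h Hh ->]|Hc].
  have := glued_sphere_weak_K5s hM _ _ (@handle_model R h) Hh HI.
  rewrite card_prod card_ord card_bool mulnC; apply.
    apply: (open_union h (fun i => disc ((4 * i)%:R, 0) `|` disc ((4 * i)%:R, 4))) => i.
    by apply: openU; exact: disc_open.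
  by case=> i b /=; rewrite negbK.
have := glued_sphere_weak_K5s hM _ _ (@crosscap_model R g) Hc HI.
rewrite card_ord; apply; last by [].
by apply: (open_union g (fun i => disc ((4 * i)%:R, 0))) => i; exact: disc_open.
Qed.

(** * From paths in an embedded graph to continua in the surface *)

Section Embedding.
Variables (R : realType) (M : topologicalType) (G : sgraph).
Variables (phi : G -> M) (gamma : G -> G -> R -> M).
Hypothesis phi_inj : injective phi.
Hypothesis gamma_arc : forall u v, edge u v ->
  [/\ {within `[0, 1], continuous (gamma u v)}, gamma u v 0 = phi u &
      gamma u v 1 = phi v].
Hypothesis gamma_phi : forall u v w, edge u v ->
  {in `]0, 1[, forall t, gamma u v t <> phi w}.
Hypothesis gamma_disj : forall u v u' v', edge u v -> edge u' v' ->
  ~ ((u = u' /\ v = v') \/ (u = v' /\ v = u')) ->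
  {in `]0, 1[ &, forall s t, gamma u v s <> gamma u' v' t}.

(** Edges enter as open arcs and vertices separately, to match the disjointness conditions of an
    embedding. *)
Definition drawn (W : seq G) : set M :=
  [set x | (exists2 w, w \in W & x = phi w) \/
     exists u v t, [/\ u \in W, v \in W, edge u v, t \in `]0, 1[ & x = gamma u v t]].

Lemma drawn_disjoint (W W' : seq G) : ~~ has (mem W) W' ->
  drawn W `&` drawn W' = set0.
Proof.
move=> /hasPn WW'; apply/seteqP; split=> // x [].
have ne u u' : u \in W -> u' \in W' -> u <> u'.
  by move=> uW /WW' + E; rewrite -E /= uW.
case=> [[w wW ->]|[u [v [t [uW vW uv t01 ->]]]]].
  case=> [[w' w'W' /phi_inj]|[u' [v' [t' [_ _ uv' t01]]]]]; first exact: ne.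
  by move/esym; exact: gamma_phi.
case=> [[w' w'W']|[u' [v' [t' [u'W' v'W' uv' t01' ]]]]]; first exact: gamma_phi.
apply: gamma_disj => //; case=> -[E1 E2].
  by move: (ne _ _ uW u'W').
by move: (ne _ _ uW v'W').
Qed.

Lemma path_continuum u p : path (@edge G) u p ->
  exists X : set M, [/\ compact X, connected X, X (phi u), X (phi (last u p)) &
    X `<=` drawn (u :: p)].
Proof.
elim: p u => [|v p IH] u /=.
  move=> _; exists [set phi u]; split=> //; [exact: compact_set1|exact: connected1|].
  by move=> _ ->; left; exists u; rewrite ?mem_head.
case/andP => uv /IH[X [cX coX Xv Xl Xd]]; have [gc g0 g1] := gamma_arc uv.
pose A := gamma u v @` `[0, 1].
have A0 : A (phi u) by exists 0; rewrite //= in_itv /= lexx ler01.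
have A1 : A (phi v) by exists 1; rewrite //= in_itv /= lexx ler01.
exists (A `|` X); split.
- by apply: compactU => //; apply: continuous_compact => //; exact: segment_compact.
- apply: connectedU => //; first by exists (phi v).
  by apply: connected_continuous_connected => //; exact: segment_connected.
- by left.
- by right.
- move=> x [[t /= t01 <-]|/Xd].
    have [->|t0] := eqVneq t 0; first by left; exists u; rewrite ?mem_head.
    have [->|t1] := eqVneq t 1; first by left; exists v; rewrite ?inE ?eqxx ?orbT.
    have /andP[h0 h1] : 0 <= t <= 1 by move: t01; rewrite in_itv.
    right; exists u, v, t; split=> //; first exact: mem_head.
      by rewrite !in_cons eqxx orbT.
    by rewrite in_itv /= !lt_neqAle h0 h1 t1 eq_sym t0.
  case=> [[w wp ->]|[a [b [t [ap bp ab t01 ->]]]]].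
    by left; exists w; rewrite // inE wp orbT.
  by right; exists a, b, t; split=> //; rewrite in_cons ?ap ?bp orbT.
Qed.
End Embedding.

(** At least half of [m] quintuples give disjoint weak drawings of [K_5], and there are at most
    [g + 1] of these. Hence [m + 1 <= 3 * (g + 1)], while [#|G|] is below [(m + 1) * 10000 * b]. *)
Lemma embedded_order_bound (R : realType) (Sigma : topologicalType) (g : nat)
    (G : sgraph) (k : nat) :
  surface R Sigma -> euler_genus R Sigma g -> embeddable R Sigma G ->
  (3 <= max_degree G)%N -> diameter G k ->
  (#|G| <= 3 * (2 * 5000 * 6) * (g.+1 * (max_degree G - 1) ^ (k %/ 2)))%N.
Proof.
move=> sS gS [phi [gamma [phi_inj gamma_arc gamma_phi gamma_disj]]] D3 [diam [u0 _]].
set Delta := max_degree G in D3 *.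
have degree_le (u : G) : (#|[pred v | edge u v]| <= Delta)%N.
  by rewrite /Delta /max_degree (leq_bigmax u).
have [P_ HP] : {P_ : G * G -> seq G & forall x, [/\ path (@edge G) x.1 (P_ x),
    last x.1 (P_ x) = x.2 & (size (P_ x) <= k)%N]}.
  apply: (@choice _ _ (fun (x : G * G) p => [/\ path (@edge G) x.1 p,
    last x.1 p = x.2 & (size p <= k)%N])) => -[u v].
  by have [n [[p [p1 p2 p3]] _] nk] := diam u v; exists p; rewrite p3.
pose P u v := P_ (u, v).
have P_path u v : path (@edge G) u (P u v) by have [] := HP (u, v).
have P_last u v : last u (P u v) = v by have [] := HP (u, v).
have P_size u v : (size (P u v) <= k)%N by have [] := HP (u, v).
have [X_ HX] : {X_ : G * G -> set Sigma & forall x,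
    [/\ compact (X_ x), connected (X_ x),
    X_ x (phi x.1), X_ x (phi x.2) & X_ x `<=` drawn phi gamma (x.1 :: P x.1 x.2)]}.
  apply: (@choice _ _ (fun (x : G * G) X => [/\ compact X, connected X,
    X (phi x.1), X (phi x.2) & X `<=` drawn phi gamma (x.1 :: P x.1 x.2)]))
    => -[u v] /=.
  have [a b uv|X [? ? ? Xl ?]] :=
    path_continuum (phi := phi) (gamma := gamma) _ (P_path u v).
    by have [] := gamma_arc a b uv.
  by rewrite P_last in Xl; exists X.
set b := (6 * (Delta - 1) ^ (k %/ 2))%N.
have b0 : (0 < b)%N by rewrite muln_gt0 expn_gt0; apply/orP; left; lia.
have V0 : (0 < #|G|)%N by apply/card_gt0P; exists u0.
pose m := (#|G| %/ (2 * 5000 * b))%N.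
have mV : (2 * 5000 * m * b <= #|G|)%N.
  by rewrite mulnAC mulnC leq_trunc_div.
have [B [f [mB fB]]] :=
  disjoint_blocks (@edge_sym G) D3 degree_le P_path P_last P_size V0 mV.
pose I := {s : 'I_m | s \in B}.
have : (#|{: I}| <= g.+1)%N.
  pose y (s : I) i := f (val s) (inord i).
  apply: (euler_genus_weak_K5s (z := fun s i => phi (y s i))
    (Gam := fun s i j => X_ (y s i, y s j)) sS gS).
  have disj (s t : I) i j i' j' : (val s != val t) ||
      uniq [:: inord i; inord j; inord i'; inord j' : 'I_5] ->
      X_ (y s i, y s j) `&` X_ (y t i', y t j') = set0.
    move=> c; have := fB _ _ _ _ _ _ (valP s) (valP t) c.
    move=> /(drawn_disjoint phi_inj gamma_phi gamma_disj) E.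
    have [_ _ _ _ d1] := HX (y s i, y s j); have [_ _ _ _ d2] := HX (y t i', y t j').
    by rewrite -subset0 -E; exact: setISS.
  split=> [s i j _|s i j _|s t i j i' j' _ _ st|s i j i' j' ij ij' u].
  - by have [] := HX (y s i, y s j).
  - by have [] := HX (y s i, y s j).
  - by apply: disj; rewrite st.
  - apply: disj; rewrite -(map_inj_uniq val_inj).
    rewrite [map _ _](_ : _ = [:: i; j; i'; j']) ?u ?orbT //=.
    by rewrite !inordK //; lia.
rewrite card_sig (_ : #|_| = #|B|); last by apply: eq_card => s; rewrite inE.
move=> Bg; have mg : (m.+1 <= 3 * g.+1)%N by lia.
have lt : (#|G| < m.+1 * (2 * 5000 * b))%N.
  by apply: ltn_ceil; rewrite muln_gt0 b0.
apply: (leq_trans (ltnW lt)); apply: (leq_trans (leq_mul mg (leqnn _))).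
by rewrite /b -!mulnA (mulnCA g.+1 2) (mulnCA g.+1 5000) (mulnCA g.+1 6).
Qed.

Theorem theorem1p1 (R : realType) :
  exists c : R, forall (Sigma : topologicalType) (g : nat),
    surface R Sigma -> euler_genus R Sigma g ->
    forall Delta k : nat, (3 <= Delta)%N -> (2 <= k)%N ->
    (~~ odd k -> c * (g%:R `^ (2 / 3) + 1) * k%:R <= Delta%:R ->
      (max_order R Delta k (embeddable R Sigma)
        <= (c * (g%:R + 1) * (Delta%:R - 1) ^+ (k %/ 2))%:E)%E) /\
    (odd k -> (2 * k + 1 <= Delta)%N ->
      (max_order R Delta k (embeddable R Sigma)
        <= (c * (g%:R `^ (3 / 2) + 1) * (Delta%:R - 1) ^+ (k %/ 2))%:E)%E).
Proof.
(* The constant is that of [embedded_order_bound]. *)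
exists (3 * (2 * 5000 * 6))%N%:R => Sigma g sS gS Delta k D3 _.
have bound : (max_order R Delta k (embeddable R Sigma) <=
    ((3 * (2 * 5000 * 6))%N%:R * (g%:R + 1) * (Delta%:R - 1) ^+ (k %/ 2))%:E)%E.
  apply: ge_ereal_sup => _ [G [eG dG kG ->]]; rewrite lee_fin; subst Delta.
  have := embedded_order_bound sS gS eG D3 kG.
  have -> : (max_degree G)%:R - 1 = (max_degree G - 1)%:R :> R.
    by rewrite natrB // (leq_trans _ D3).
  by rewrite -natrX natr1 -mulrA -!natrM ler_nat.
split=> // _ _; apply: (le_trans bound); rewrite lee_fin.
apply: ler_wpM2r; first by apply: exprn_ge0; rewrite subr_ge0 ler1n; lia.
apply: ler_wpM2l; first exact: ler0n.
(* For odd [k] it remains that a natural number is at most its power with exponent 3/2; 0 is treated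
   apart because monotonicity in the exponent needs a base at least 1. *)
rewrite lerD2r; case: g {sS gS bound} => [|g]; first exact: powR_ge0.
by rewrite -{1}(powRr1 (ler0n R g.+1)) ler_powR ?ler1n //; lra.
Qed.
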